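(* Let $k$ be a field and $R=k[x_1,\dots,x_n]$. If $I\subset R$ is a reduced monomial ideal and $\alpha\in\{-1,0\}^n$, then $$\beta_{i,-\alpha}(I^{\vee})=m_{|\alpha|-i,\,\alpha}$$ for all $i\ge 0$.
   Context: $R$ is $\mathbb{Z}^n$-graded by $\deg(x_i)=\varepsilon_i$ (canonical basis of $\mathbb{Z}^n$). A reduced monomial ideal is a radical (squarefree) monomial ideal. For a reduced monomial ideal $J$, the graded Betti numbers are $\beta_{i,\gamma}(J)=\dim_k\mathrm{Tor}^R_i(J,k)_\gamma$, $\gamma\in\mathbb{Z}^n$. The Alexander dual of $I$ is $$I^{\vee}=\Bigl\langle \prod_{i\in S}x_i \;\Big|\; S\subseteq\{1,\dots,n\},\ \prod_{i\notin S}x_i\notin I\Bigr\rangle .$$ For $\alpha\in\{-1,0\}^n$ put $|\alpha|=|\alpha_1|+\dots+|\alpha_n|$ and $\mathfrak{p}_\alpha=\langle x_i\mid\alpha_i=-1\rangle$. Let $X\subset\mathbb{A}^n_k$ be the arrangement defined by $I$. $P(X)$ is the poset whose elements $p$ correspond to the intersections $X_p$ of irreducible components of $X$, ordered by inclusion; $I_p$ is the radical ideal defining $X_p$ and $h(p)$ its height. For $p\in P(X)$, $K(>p)$ is the simplicial complex with vertices the $q\in P(X)$ with $q>p$ and simplices the chains of such elements. Define, for every integer $r$, $m_{r,p}=\dim_k\tilde H_{h(p)-r-1}(K(>p);k)$ (reduced simplicial homology, where the reduced homology of the empty complex is $k$ in degree $-1$ and zero otherwise, and that of a non-empty complex is zero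 in degree $-1$). (If $\mathrm{char}\,k=0$, for $r\ge0$ these are the multiplicities of the characteristic cycle of $H^r_I(R)$.) Set $m_{r,\alpha}:=m_{r,p}$ if there is $p\in P(X)$ with $\mathfrak{p}_\alpha=I_p$, and $m_{r,\alpha}:=0$ otherwise. *)

(* Defs.v *)
From mathcomp Require Import all_boot all_order all_algebra.
From mathcomp Require Import finmap boolp classical_sets cardinality.
From mathcomp Require Import mpoly.

Set Implicit Arguments.
Unset Strict Implicit.
Unset Printing Implicit Defensive.

Import Order.TTheory GRing.Theory Num.Theory.
Local Open Scope ring_scope.

(* [%classic] sets are possibly infinite sets (predicates in Prop); the
   undecorated [{set V}] are the finite sets over a finType V. *)

Section Ideals.
Variables (k : fieldType) (n : nat).
Local Notation R := {mpoly k[n]}.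

Definition is_ideal (J : set R) : Prop :=
  [/\ J 0, forall f g, J f -> J g -> J (f + g) & forall a f, J f -> J (a * f)].

Definition ideal_gen (G : set R) : set R := smallest is_ideal G.

Definition radical_ideal (J : set R) : Prop :=
  is_ideal J /\ forall f e, J (f ^+ e) -> J f.

Definition prime_ideal (P : set R) : Prop :=
  [/\ is_ideal P, ~ P 1 & forall f g, P (f * g) -> P f \/ P g].

Definition monomial_ideal (J : set R) : Prop :=
  exists M : set 'X_{1..n},
    J = ideal_gen ((fun m : 'X_{1..n} => 'X_[m] : R) @` M)%classic.

Definition reduced_monomial_ideal (J : set R) : Prop :=
  monomial_ideal J /\ radical_ideal J.

Definition sqfree (S : {set 'I_n}) : R := \prod_(i in S) 'X_i.

Definition alexander_dual (I : set R) : set R :=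
  ideal_gen [set f | exists2 S : {set 'I_n}, ~ I (sqfree (~: S)%SET)
                                           & f = sqfree S]%classic.

Definition face_ideal (alpha : 'rV[int]_n) : set R :=
  ideal_gen [set f | exists2 i : 'I_n, alpha 0 i = -1 & f = 'X_i]%classic.

Definition prime_chain_to (P : set R) (h : nat) : Prop :=
  exists c : nat -> set R,
    [/\ forall j, (j <= h)%N -> prime_ideal (c j),
        forall j, (j < h)%N -> (c j `<` c j.+1)%classic
      & c h = P].

Definition prime_has_height (P : set R) (h : nat) : Prop :=
  prime_chain_to P h /\ forall h', prime_chain_to P h' -> (h' <= h)%N.

(* The height of an ideal is the least height of a prime containing it. *)
Definition has_height (J : set R) (h : nat) : Prop :=
  (exists P, [/\ prime_ideal P, (J `<=` P)%classic & prime_has_height P h]) /\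
  (forall P h', prime_ideal P -> (J `<=` P)%classic -> prime_has_height P h' ->
     (h <= h')%N).

Definition height (J : set R) : nat := xget 0%N (has_height J).

End Ideals.

(* Since k is an arbitrary field, affine space is the scheme Spec R: its points
   are the prime ideals, and a subset of it is a set of prime ideals. *)
Section Arrangement.
Variables (k : fieldType) (n : nat).
Local Notation R := {mpoly k[n]}.
Local Notation subspace := (set (set R)).

Definition zeros (J : set R) : subspace :=
  [set P | prime_ideal P /\ J `<=` P]%classic.

Definition zariski_closed (Z : subspace) : Prop :=
  exists J : set R, Z = zeros J.

Definition vanishing_ideal (Z : subspace) : set R :=
  (\bigcap_(P in Z) P)%classic.

Definition irreducible (Z : subspace) : Prop :=
  (Z !=set0)%classic /\
  forall A B, zariski_closed A -> zariski_closed B ->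
    (Z `<=` A `|` B -> Z `<=` A \/ Z `<=` B)%classic.

Definition irreducible_component (X Z : subspace) : Prop :=
  [/\ (Z `<=` X)%classic, irreducible Z
    & forall Z', (Z' `<=` X)%classic -> irreducible Z' ->
        (Z `<=` Z')%classic -> Z' = Z].

(* Only non-empty families of components are intersected. *)
Definition component_intersections (X : subspace) : set subspace :=
  [set Y | exists C : set subspace,
     [/\ C !=set0, C `<=` irreducible_component X
       & Y = \bigcap_(Z in C) Z]]%classic.

(* A Noetherian space has finitely many irreducible components, so the set of
   their intersections is finite and [fset_set] merely repackages it. *)
Definition arr_poset (I : set R) : finType :=
  fset_set (component_intersections (zeros I)).

Definition arr_space (I : set R) (p : arr_poset I) : subspace := fsval p.

Definition arr_ideal (I : set R) (p : arr_poset I) : set R :=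
  vanishing_ideal (arr_space p).

Definition arr_lt (I : set R) (p q : arr_poset I) : bool :=
  `[< (arr_space p `<` arr_space q)%classic >].

End Arrangement.

(* A simplicial complex on a finite type V is given by its set of faces, which
   contains the empty face; elements of V need not all be vertices. *)
Section Simplicial.
Variables (k : fieldType) (V : finType).
Local Notation N := #|{: {set V}}|.

Definition subset_of (a : 'I_N) : {set V} := enum_val a.

(* Simplices are oriented by the enumeration order of V. *)
Definition face_sign (s : {set V}) (v : V) : k :=
  (-1) ^+ #|[set u in s | (enum_rank u < enum_rank v)%N]|.

(* Boundary operator on the vector space with basis all subsets of V, acting on
   row vectors. *)
Definition simplicial_boundary : 'M[k]_N :=
  \matrix_(a, b)
     \sum_(v in subset_of a | subset_of b == subset_of a :\ v)
        face_sign (subset_of a) v.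

(* The span of the faces with j vertices, i.e. of dimension j - 1. *)
Definition face_space (K : {set {set V}}) (j : nat) : 'M[k]_N :=
  diag_mx (\row_a ((subset_of a \in K) && (#|subset_of a| == j))%:R).

Definition reduced_homology_dim (K : {set {set V}}) (d : int) : nat :=
  match (d + 1)%R with
  | Posz j =>
      (\rank (face_space K j :&: kermx simplicial_boundary)%MS
       - \rank (face_space K j.+1 *m simplicial_boundary))%N
  | Negz _ => 0%N
  end.

Definition order_complex_above (lt : rel V) (p : V) : {set {set V}} :=
  [set s : {set V} | [forall q in s, lt p q]
     && [forall q in s, forall q' in s, [|| q == q', lt q q' | lt q' q]]].

End Simplicial.

Section Multiplicity.
Variables (k : fieldType) (n : nat).

Definition mult_at (I : set {mpoly k[n]}) (r : int) (p : arr_poset I) : nat :=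
  reduced_homology_dim k (order_complex_above (@arr_lt k n I) p)
    ((height (arr_ideal p))%:Z - r - 1)%R.

Definition mult (I : set {mpoly k[n]}) (r : int) (alpha : 'rV[int]_n) : nat :=
  if [pick p : arr_poset I | `[< face_ideal alpha = arr_ideal p >]] is Some p
  then mult_at r p else 0%N.

End Multiplicity.

Section Betti.
Variables (k : fieldType) (n : nat).
Local Notation R := {mpoly k[n]}.

Definition multidegree (m : 'X_{1..n}) : 'rV[int]_n := \row_i (m i)%:Z.

Definition homogeneous (g : 'rV[int]_n) (f : R) : Prop :=
  forall m, m \in msupp f -> multidegree m = g.

(* A Z^n-graded resolution of J by free modules of finite rank: the i-th module
   is R^(gf_rank i), its a-th basis vector lies in degree gf_deg a, and maps act
   on row vectors from the right. *)
Record graded_free_resolution (J : set R) := GradedFreeResolution {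
  gf_rank : nat -> nat;
  gf_deg : forall i, 'I_(gf_rank i) -> 'rV[int]_n;
  gf_diff : forall i, 'M[R]_(gf_rank i.+1, gf_rank i);
  gf_aug : 'cV[R]_(gf_rank 0);
  gf_diff_homog : forall i a b,
    homogeneous (gf_deg a - gf_deg b) (gf_diff i a b);
  gf_aug_homog : forall a, homogeneous (gf_deg a) (gf_aug a 0);
  gf_aug_range : forall f, J f <-> exists v : 'rV_(gf_rank 0), f = (v *m gf_aug) 0 0;
  gf_exact0 : forall v : 'rV_(gf_rank 0),
    v *m gf_aug = 0 <-> exists w, v = w *m gf_diff 0;
  gf_exactS : forall i (v : 'rV_(gf_rank i.+1)),
    v *m gf_diff i = 0 <-> exists w, v = w *m gf_diff i.+1
}.

Section Tor.
Variables (J : set R) (F : graded_free_resolution J).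

(* Tensoring with k = R / (x_1, ..., x_n) keeps the constant coefficients of the
   matrix entries. *)
Definition tensor_diff i : 'M[k]_(gf_rank F i.+1, gf_rank F i) :=
  map_mx (mcoeff 0%MM) (gf_diff F i).

Definition tensor_out i : 'M[k]_(gf_rank F i, gf_rank F i.-1) :=
  match i return 'M[k]_(gf_rank F i, gf_rank F i.-1) with
  | 0 => 0
  | j.+1 => tensor_diff j
  end.

Definition tensor_degree i (g : 'rV[int]_n) : 'M[k]_(gf_rank F i) :=
  diag_mx (\row_a (gf_deg a == g)%:R).

Definition tor_dim i (g : 'rV[int]_n) : nat :=
  (\rank (tensor_degree i g :&: kermx (tensor_out i))%MS
   - \rank (tensor_degree i.+1 g *m tensor_diff i))%N.

End Tor.

(* dim_k Tor_i(J, k)_g; Tor does not depend on the resolution. *)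
Definition graded_betti (J : set R) (i : nat) (g : 'rV[int]_n) : nat :=
  xget 0%N [set b | exists F : graded_free_resolution J, b = tor_dim F i g]%classic.

End Betti.

Definition abs_weight n (alpha : 'rV[int]_n) : int := \sum_i `|alpha 0 i|.

(* Main.v *)
Require Import Defs.
From mathcomp Require Import all_boot all_order all_algebra.
From mathcomp Require Import finmap boolp classical_sets cardinality.
From mathcomp Require Import mpoly.
Import Order.TTheory GRing.Theory Num.Theory.
Local Open Scope ring_scope.

(** A squarefree monomial ideal [I] is the intersection of the primes
    [p_F = <x_i, i in F>] containing it.  The minimal such [F] give both the
    irreducible components of [X] and the generators [x^F] of the Alexander dual,
    so the elements of [P(X)] are the unions of minimal [F]'s, with order reversed.
    Label the order complex of [P(X)] by giving a chain the union of its labels,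
    that is, the label of its smallest element.  For each degree [b] the chains
    whose label is at most [b] form a cone over the largest union below [b] (or
    there are none), hence the labelled complex supports a free resolution of the
    Alexander dual, in general not minimal.  After tensoring with [k] the part of
    degree [p] is spanned by the chains having [p] as smallest element; removing
    [p] identifies it with the augmented chain complex of [K(>p)], shifted by one.
    Graded Betti numbers do not depend on the resolution because two resolutions
    are homotopy equivalent through homogeneous maps.  Finally [p_F] has height
    [#|F|]: a chain of primes ending at [p_F] extends to one ending at
    [<x_1, ..., x_n>], and a strict chain of primes cannot have length greater than
    [n], since choosing [f_j] in [P_(j+1)] but not in [P_j] makes the [f_j]
    algebraically independent. *)

Set Implicit Arguments.
Unset Strict Implicit.
Unset Printing Implicit Defensive.

(** * The simplicial boundary and cones *)

Section SimplicialCone.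
Variables (k : fieldType) (V : finType).
Local Notation N := #|{: {set V}}|.
Local Notation bdry := (simplicial_boundary k V).
Implicit Types (s : {set V}) (p v w : V).

Definition set_row s : 'rV[k]_N := delta_mx 0 (enum_rank s).

Lemma set_row_boundary s :
  set_row s *m bdry = \sum_(v in s) face_sign k s v *: set_row (s :\ v).
Proof.
rewrite /set_row -rowE; apply/rowP => b; rewrite !mxE summxE big_mkcondr /=.
rewrite /subset_of enum_rankK; apply: eq_bigr => v _.
rewrite !mxE eqxx /= -(inj_eq (@enum_rank_inj _)) enum_valK.
by case: eqP => _; rewrite ?mulr1 ?mulr0.
Qed.

(** The sign is the one with which the boundary removes [p] from [p |: s], so that the cone is a
    contracting homotopy of the full simplex. *)
Definition cone_mx p : 'M[k]_N :=
  \matrix_(a < N, b < N)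
     if (p \notin subset_of a) && (subset_of b == p |: subset_of a)
     then face_sign k (p |: subset_of a) p else 0.

Lemma set_row_cone p s :
  set_row s *m cone_mx p =
  if p \in s then 0 else face_sign k (p |: s) p *: set_row (p |: s).
Proof.
rewrite /set_row -rowE; apply/rowP => b; rewrite !mxE /subset_of enum_rankK.
case: (p \in s); rewrite /= !mxE // eqxx /= -(inj_eq (@enum_rank_inj _)) enum_valK.
by case: eqP => _; rewrite ?mulr1 ?mulr0.
Qed.

Lemma face_sign_sqr s v : face_sign k s v * face_sign k s v = 1.
Proof. by rewrite /face_sign -expr2 sqrr_sign. Qed.

Lemma face_signU p s v : p \notin s ->
  face_sign k (p |: s) v =
  face_sign k s v * (-1) ^+ (enum_rank p < enum_rank v)%N.
Proof.
move=> pNs; rewrite /face_sign -exprD; congr (_ ^+ _).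
rewrite (cardsD1 p) !inE eqxx /= addnC; congr (_ + _)%N.
apply: eq_card => u; rewrite !inE.
by case: eqP => // ->; rewrite (negbTE pNs).
Qed.

(** If [p] lies in [s], only the face [s :\ p] has a non-zero cone, and that cone is [s]. Otherwise
    the term removing [p] gives back [s], and the terms removing some [v] in [s] cancel in pairs:
    exactly one of [p], [v] precedes the other, which makes the two signs opposite. *)
Lemma boundary_cone p : bdry *m cone_mx p + cone_mx p *m bdry = 1%:M.
Proof.
apply/row_matrixP => a; rewrite -[a]enum_valK; move: (enum_val a) => s.
rewrite [LHS]rowE [RHS]rowE -/(set_row s) mulmx1 mulmxDr !mulmxA.
rewrite set_row_boundary set_row_cone mulmx_suml.
under eq_bigr do rewrite -scalemxAl set_row_cone !inE.
case: ifPn => [ps|pNs].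
  rewrite mul0mx addr0 (big_setD1 p) //= eqxx /= big1 => [|v].
    by rewrite addr0 finset.setD1K // scalerA face_sign_sqr scale1r.
  by rewrite !inE eq_sym => /andP[-> _]; rewrite scaler0.
rewrite -scalemxAl set_row_boundary big_setU1 //= finset.setU1K // scalerDr scalerA.
rewrite face_sign_sqr scale1r addrCA scaler_sumr -big_split /=.
rewrite big1 ?addr0 // => v vs.
have pv : p != v by apply: contraNneq pNs => ->.
rewrite andbF scalerA.
have -> : (p |: s) :\ v = p |: (s :\ v).
  by rewrite finset.setDUl (finset.setDidPl _) // finset.disjoints1 inE.
rewrite scalerA -scalerDl.
have -> : face_sign k (p |: s) p =
          face_sign k (p |: (s :\ v)) p * (-1) ^+ (enum_rank v < enum_rank p)%N.
  rewrite -face_signU; last by rewrite !inE eq_sym (negbTE pv) eqxx.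
  by rewrite finset.setUCA finset.setD1K.
rewrite (face_signU _ pNs) -[face_sign k s v * face_sign k _ p]mulrC.
have -> : (enum_rank p < enum_rank v)%N = ~~ (enum_rank v < enum_rank p)%N.
  by rewrite -leqNgt ltn_neqAle (inj_eq val_inj) (inj_eq enum_rank_inj) pv.
by case: (_ < _)%N; rewrite /= expr1 expr0 ?mulr1 mulrN1 ?mulNr ?mulrN subrr scale0r.
Qed.

(* By [boundary_cone] the square of the boundary commutes with every cone
   operator, so it vanishes by induction on the number of vertices. *)
Lemma boundary_boundary : bdry *m bdry = 0.
Proof.
have comm p : cone_mx p *m (bdry *m bdry) = bdry *m bdry *m cone_mx p.
  have e1 : bdry *m cone_mx p = 1%:M - cone_mx p *m bdry.
    by rewrite -(boundary_cone p) addrK.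
  rewrite -!mulmxA e1 mulmxBr mulmx1 [in RHS]mulmxA e1.
  by rewrite mulmxBl mul1mx opprB addrC subrK mulmxA.
apply/row_matrixP => a; rewrite -[a]enum_valK; move: (enum_val a) => s.
rewrite rowE -/(set_row s) row0.
have [m] := ubnP #|s|; elim: m s => // m IH s sm.
have [->|[p ps]] := set_0Vmem s.
  by rewrite mulmxA set_row_boundary big_set0 mul0mx.
have := set_row_cone p (s :\ p).
rewrite finset.setD11 finset.setD1K // => /(congr1 ( *:%R (face_sign k s p))).
rewrite scalerA face_sign_sqr scale1r => <-.
rewrite -scalemxAl -mulmxA comm mulmxA IH ?mul0mx ?scaler0 //.
by rewrite (cardsD1 p) ps in sm.
Qed.
End SimplicialCone.

(** * Homogeneous matrices and their scalar coefficients *)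

Section Strands.
Variables (k : fieldType) (n : nat).
Local Notation R := {mpoly k[n]}.
Local Notation degree := 'rV[int]_n.
Implicit Types (f g h : degree) (p : R) (m : 'X_{1..n}).

Definition ledeg g h : bool := [forall j, g 0 j <= h 0 j].

Lemma ledegP g h : reflect (forall j, g 0 j <= h 0 j) (ledeg g h).
Proof. exact: forallP. Qed.

Lemma ledeg_refl g : ledeg g g.
Proof. by apply/ledegP => j. Qed.

Lemma ledeg_trans h g f : ledeg g h -> ledeg h f -> ledeg g f.
Proof.
by move=> /ledegP gh /ledegP hf; apply/ledegP => j; apply: le_trans (hf j).
Qed.

Lemma ledeg_anti g h : ledeg g h -> ledeg h g -> g = h.
Proof.
move=> /ledegP gh /ledegP hg; apply/rowP => j.
by apply/le_anti; rewrite gh hg.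
Qed.

Lemma ledeg_sub0 g h : ledeg 0 (h - g) = ledeg g h.
Proof. by apply: eq_forallb => j; rewrite !mxE subr_ge0. Qed.

Definition degree_mnm g : 'X_{1..n} := [multinom absz (g 0%R j) | j < n].

Lemma multidegreeK : cancel (@multidegree n) degree_mnm.
Proof. by move=> m; apply/mnmP => j; rewrite mnmE mxE absz_nat. Qed.

Lemma degree_mnmK g : ledeg 0 g -> multidegree (degree_mnm g) = g.
Proof.
move=> /ledegP g0; apply/rowP => j; rewrite !mxE mnmE gez0_abs //.
by have := g0 j; rewrite mxE.
Qed.

Lemma multidegree_ge0 m : ledeg 0 (multidegree m).
Proof. by apply/ledegP => j; rewrite !mxE. Qed.

Lemma multidegreeD m1 m2 :
  multidegree (m1 + m2)%MM = multidegree m1 + multidegree m2.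
Proof. by apply/rowP => j; rewrite !mxE mnmDE PoszD. Qed.

(* Zero when [g] has a negative entry, in which case [degree_mnm g] is junk;
   likewise for [degree_coef]. *)
Definition degree_monomial g : R :=
  if ledeg 0 g then 'X_[degree_mnm g] else 0.

Definition degree_coef p g : k :=
  if ledeg 0 g then p@_(degree_mnm g) else 0.

Lemma degree_monomialD g h : ledeg 0 g -> ledeg 0 h ->
  degree_monomial (g + h) = degree_monomial g * degree_monomial h.
Proof.
move=> g0 h0; rewrite -(degree_mnmK g0) -(degree_mnmK h0) -multidegreeD.
by rewrite /degree_monomial !multidegree_ge0 !multidegreeK mpolyXD.
Qed.

Lemma degree_coefMX p g h : ledeg 0 g ->
  degree_coef (p * degree_monomial g) h = degree_coef p (h - g).
Proof.
move=> g0; rewrite /degree_coef /degree_monomial g0.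
case: (boolP (ledeg 0 (h - g))) => [hg0|].
  have e : h = multidegree (degree_mnm g + degree_mnm (h - g))%MM.
    by rewrite multidegreeD !degree_mnmK // addrC subrK.
  by rewrite [in ledeg 0 h]e multidegree_ge0 [in degree_mnm h]e multidegreeK mcoeffMX.
rewrite ledeg_sub0; case: (boolP (ledeg 0 h)) => // h0 ngh.
apply/eqP; rewrite mcoeff_eq0; apply: contra ngh => /msuppM_le.
case/allpairsP => -[m1 m2] /= [_]; rewrite msuppX inE => /eqP -> e.
rewrite -(degree_mnmK h0) e multidegreeD (degree_mnmK g0) -ledeg_sub0 addrK.
exact: multidegree_ge0.
Qed.

Lemma degree_coefD p q g : degree_coef (p + q) g = degree_coef p g + degree_coef q g.
Proof. by rewrite /degree_coef; case: ifP; rewrite ?addr0 // mcoeffD. Qed.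

Lemma degree_coef_sum (T : Type) (s : seq T) (P : pred T) (F : T -> R) g :
  degree_coef (\sum_(t <- s | P t) F t) g = \sum_(t <- s | P t) degree_coef (F t) g.
Proof.
apply: (big_morph (fun p => degree_coef p g)) => [p q|]; first exact: degree_coefD.
by rewrite /degree_coef mcoeff0; case: ifP.
Qed.

Lemma degree_coefZ c p g : degree_coef (c *: p) g = c * degree_coef p g.
Proof. by rewrite /degree_coef; case: ifP; rewrite ?mulr0 // mcoeffZ. Qed.

Lemma degree_coef_monomial g : ledeg 0 g -> degree_coef (degree_monomial g) g = 1.
Proof. by rewrite /degree_coef /degree_monomial => ->; rewrite mcoeffX eqxx. Qed.

Lemma homogeneousP g p : homogeneous g p -> p = degree_coef p g *: degree_monomial g.
Proof.
move=> hp; apply/mpolyP => m; rewrite mcoeffZ.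
case: (boolP (m \in msupp p)) => [/hp <-|mp].
  rewrite /degree_coef /degree_monomial multidegree_ge0 multidegreeK.
  by rewrite mcoeffX eqxx mulr1.
rewrite (memN_msupp_eq0 mp) /degree_coef /degree_monomial.
case: ifP => g0; last by rewrite mul0r.
rewrite mcoeffX; case: eqP => e; last by rewrite mulr0.
by rewrite e (memN_msupp_eq0 mp) mul0r.
Qed.

Lemma homogeneous_monomial c g : homogeneous g (c *: degree_monomial g).
Proof.
move=> m; rewrite /degree_monomial; case: ifP => g0; last by rewrite scaler0 msupp0.
by move/msuppZ_le; rewrite msuppX inE => /eqP ->; rewrite degree_mnmK.
Qed.

(** Degree-preserving maps of graded free modules are handled through their scalar coefficients: the
    entry [(a, b)] is a multiple of the monomial of degree [dr a - dc b], which exists only when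
    [dc b] is at most [dr a]. On triangular matrices [homog_mx] respects products and is inverted by
    [strand_mx]. *)
Definition triangular r c (dr : 'I_r -> degree) (dc : 'I_c -> degree)
    (A : 'M[k]_(r, c)) : Prop :=
  forall a b, A a b != 0 -> ledeg (dc b) (dr a).

Definition homog_mx r c (dr : 'I_r -> degree) (dc : 'I_c -> degree)
    (A : 'M[k]_(r, c)) : 'M[R]_(r, c) :=
  \matrix_(a, b) (A a b *: degree_monomial (dr a - dc b)).

(** For a matrix that is not homogeneous this extracts its degree-preserving component. *)
Definition strand_mx r c (dr : 'I_r -> degree) (dc : 'I_c -> degree)
    (M : 'M[R]_(r, c)) : 'M[k]_(r, c) :=
  \matrix_(a, b) degree_coef (M a b) (dr a - dc b).

Lemma triangular_mul r l c (dr : 'I_r -> degree) (dm : 'I_l -> degree)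
    (dc : 'I_c -> degree) A B :
  triangular dr dm A -> triangular dm dc B -> triangular dr dc (A *m B).
Proof.
move=> tA tB a b; rewrite mxE.
apply: contra_neqT => nab; apply: big1 => j _; apply/eqP.
apply: contraNT nab; rewrite mulf_eq0 negb_or => /andP[/tA h1 /tB h2].
exact: ledeg_trans h2 h1.
Qed.

Lemma triangularB r c (dr : 'I_r -> degree) (dc : 'I_c -> degree) A B :
  triangular dr dc A -> triangular dr dc B -> triangular dr dc (A - B).
Proof.
move=> tA tB a b; rewrite !mxE; apply: contra_neqT => nab.
have -> : A a b = 0 by apply: contraNeq nab => /tA.
have -> : B a b = 0 by apply: contraNeq nab => /tB.
by rewrite subr0.
Qed.

Lemma triangular1 r (dr : 'I_r -> degree) : triangular dr dr 1%:M.
Proof.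
move=> a b; rewrite mxE.
by have [-> _|] := eqVneq a b; [exact: ledeg_refl|rewrite eqxx].
Qed.

Lemma homog_mxM r l c (dr : 'I_r -> degree) (dm : 'I_l -> degree)
    (dc : 'I_c -> degree) A B :
  triangular dr dm A -> triangular dm dc B ->
  homog_mx dr dm A *m homog_mx dm dc B = homog_mx dr dc (A *m B).
Proof.
move=> tA tB; apply/matrixP => a b; rewrite !mxE scaler_suml.
apply: eq_bigr => j _; rewrite !mxE -scalerAl -scalerAr scalerA.
have [->|/tA rj] := eqVneq (A a j) 0; first by rewrite !mul0r !scale0r.
have [->|/tB jb] := eqVneq (B j b) 0; first by rewrite !mulr0 !scale0r.
by rewrite -degree_monomialD ?ledeg_sub0 // addrA subrK.
Qed.

Lemma triangular_strand r c (dr : 'I_r -> degree) (dc : 'I_c -> degree) M :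
  triangular dr dc (strand_mx dr dc M).
Proof.
move=> a b; rewrite mxE /degree_coef -[ledeg (dc b) _]ledeg_sub0; case: ifP => //.
by rewrite eqxx.
Qed.

Lemma homog_mxK r c (dr : 'I_r -> degree) (dc : 'I_c -> degree) A :
  triangular dr dc A -> strand_mx dr dc (homog_mx dr dc A) = A.
Proof.
move=> tA; apply/matrixP => a b; rewrite !mxE degree_coefZ.
have [->|/tA ab] := eqVneq (A a b) 0; first by rewrite mul0r.
by rewrite degree_coef_monomial ?mulr1 // ledeg_sub0.
Qed.

Lemma strand_mxK r c (dr : 'I_r -> degree) (dc : 'I_c -> degree)
    (M : 'M[R]_(r, c)) :
  (forall a b, homogeneous (dr a - dc b) (M a b)) ->
  homog_mx dr dc (strand_mx dr dc M) = M.
Proof. by move=> hM; apply/matrixP => a b; rewrite !mxE -homogeneousP. Qed.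

Lemma strand_mxMr r l c (dr : 'I_r -> degree) (dm : 'I_l -> degree)
    (dc : 'I_c -> degree) (M : 'M[R]_(r, l)) B :
  triangular dm dc B ->
  strand_mx dr dc (M *m homog_mx dm dc B) = strand_mx dr dm M *m B.
Proof.
move=> tB; apply/matrixP => a b; rewrite !mxE degree_coef_sum.
apply: eq_bigr => j _; rewrite !mxE -scalerAr degree_coefZ.
have [->|/tB jb] := eqVneq (B j b) 0; first by rewrite mul0r mulr0.
by rewrite degree_coefMX ?ledeg_sub0 // mulrC opprB addrA subrK.
Qed.

Lemma homog_mx0 r c (dr : 'I_r -> degree) (dc : 'I_c -> degree) :
  homog_mx dr dc 0 = 0.
Proof. by apply/matrixP => a b; rewrite !mxE scale0r. Qed.

Lemma strand_mx0 r c (dr : 'I_r -> degree) (dc : 'I_c -> degree) :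
  strand_mx dr dc 0 = 0.
Proof. by apply/matrixP => a b; rewrite !mxE /degree_coef mcoeff0; case: ifP. Qed.

(** Exactness over [R] lifts [U] row by row, possibly by inhomogeneous rows. Since [A] is
    homogeneous, the degree-preserving component of such a lift is still a lift. *)
Lemma strand_exact r l c (dr : 'I_r -> degree) (dm : 'I_l -> degree)
    (dc : 'I_c -> degree) (A : 'M[R]_(r, l)) (B : 'M[R]_(l, c)) :
  (forall a b, homogeneous (dr a - dm b) (A a b)) ->
  (forall a b, homogeneous (dm a - dc b) (B a b)) ->
  (forall v : 'rV_l, v *m B = 0 -> exists w, v = w *m A) ->
  forall q (dq : 'I_q -> degree) U, triangular dq dm U ->
    U *m strand_mx dm dc B = 0 ->
    exists2 W, triangular dq dr W & U = W *m strand_mx dr dm A.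
Proof.
move=> hA hB ex q dq U tU UB.
have UB0 : homog_mx dq dm U *m B = 0.
  rewrite -(strand_mxK hB) homog_mxM ?UB ?homog_mx0 //.
  exact: triangular_strand.
have /choice [W hW] : forall i, exists w, row i (homog_mx dq dm U) = w *m A.
  by move=> i; apply: ex; rewrite -row_mul UB0 row0.
exists (strand_mx dq dr (\matrix_i W i)); first exact: triangular_strand.
rewrite -(strand_mxMr dq _ (@triangular_strand _ _ dr dm A)) strand_mxK //.
rewrite -[LHS](homog_mxK tU); congr strand_mx.
by apply/row_matrixP => i; rewrite row_mul rowK hW.
Qed.

Lemma sum_homog_rows c (dc : 'I_c -> degree) (v : 'rV[R]_c) :
  exists B : seq degree, v = \sum_(b <- B)
    homog_mx (fun _ => b) dc (strand_mx (fun _ => b) dc v).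
Proof.
pose L a := [seq multidegree m + dc a | m <- msupp (v 0 a)].
(* These are the degrees of the terms of [v], each listed once so that no term is counted twice. *)
exists (undup (flatten [seq L a | a <- enum 'I_c])).
apply/rowP => a; rewrite summxE; apply/mpolyP => m; rewrite raddf_sum /=.
under eq_bigr do rewrite !mxE mcoeffZ /degree_coef /degree_monomial.
have term b : (if ledeg 0 (b - dc a) then (v 0 a)@_(degree_mnm (b - dc a)) else 0)
    * (if ledeg 0 (b - dc a) then 'X_[degree_mnm (b - dc a)] else 0 : R)@_m =
    if b == multidegree m + dc a then (v 0 a)@_m else 0.
  rewrite -subr_eq; case: ifPn => [h|].
    rewrite mcoeffX -(can_eq multidegreeK) degree_mnmK //.
    by case: eqP => [->|_]; rewrite ?multidegreeK ?mulr1 ?mulr0.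
  by rewrite mul0r; case: eqP => // ->; rewrite multidegree_ge0.
under eq_bigr do rewrite term.
rewrite -big_mkcond /=; case: (boolP (m \in msupp (v 0 a))) => [ma|ma]; last first.
  by rewrite (memN_msupp_eq0 ma) big1.
have bB : multidegree m + dc a \in undup (flatten [seq L a | a <- enum 'I_c]).
  rewrite mem_undup; apply/flattenP; exists (L a); last by apply: map_f.
  by apply: map_f; rewrite mem_enum.
by rewrite -big_filter filter_pred1_uniq ?undup_uniq // big_seq1.
Qed.

(** A kernel element is the sum of its homogeneous components, each of which is again in the kernel;
    so exactness over [R] can be tested on scalar rows, one degree at a time. *)
Lemma homog_exact r l c (dr : 'I_r -> degree) (dm : 'I_l -> degree)
    (dc : 'I_c -> degree) (A : 'M[k]_(r, l)) (B : 'M[k]_(l, c)) :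
  triangular dr dm A -> triangular dm dc B -> A *m B = 0 ->
  (forall b (u : 'rV_l), triangular (fun _ => b) dm u -> u *m B = 0 ->
     exists2 w, triangular (fun _ => b) dr w & u = w *m A) ->
  forall v : 'rV_l, v *m homog_mx dm dc B = 0 <->
    exists w, v = w *m homog_mx dr dm A.
Proof.
move=> tA tB AB ex v; split=> [vB|[w ->]]; last first.
  by rewrite -mulmxA homog_mxM // AB homog_mx0 mulmx0.
have /choice [w hw] : forall b, exists w : 'rV[R]_r,
    homog_mx (fun _ => b) dm (strand_mx (fun _ => b) dm v) = w *m homog_mx dr dm A.
  move=> b; have [||w tw ->] := ex b (strand_mx (fun _ => b) dm v).
  - exact: triangular_strand.
  - by rewrite -(strand_mxMr _ _ tB) vB strand_mx0.
  by exists (homog_mx (fun _ => b) dr w); rewrite homog_mxM.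
have [L ->] := sum_homog_rows dm v.
by exists (\sum_(b <- L) w b); rewrite mulmx_suml; apply: eq_bigr => b _.
Qed.

End Strands.

(** * Independence of the resolution *)

Section RankDifference.
Variable k : fieldType.

(** The last hypothesis says that the kernel of the map from [Z] to the quotient of [Z'] by [B']
    lies in [B]; rank-nullity on both sides then gives the inequality. Used in both directions, this
    compares homology dimensions without forming quotient spaces. *)
Lemma rank_diff_le m1 m2 p q r s (f : 'M[k]_(m1, m2))
    (Z : 'M_(p, m1)) (B : 'M_(q, m1)) (Z' : 'M_(r, m2)) (B' : 'M_(s, m2)) :
  (Z *m f <= Z')%MS -> (B' <= Z')%MS ->
  (forall u : 'rV_m1, (u <= Z)%MS -> (u *m f <= B')%MS -> (u <= B)%MS) ->
  (\rank Z - \rank B <= \rank Z' - \rank B')%N.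
Proof.
move=> Zf BZ' inj; pose c := cokermx B'.
have hB : (\rank (Z :&: kermx (f *m c)) <= \rank B)%N.
  apply/mxrankS/rV_subP => u; rewrite sub_capmx => /andP[uZ /sub_kermxP].
  by rewrite mulmxA => /eqP uf; apply: inj uZ _; rewrite submxE.
have hB' : (\rank B' <= \rank (Z' :&: kermx c))%N.
  apply/mxrankS; rewrite sub_capmx BZ' /=; apply/sub_kermxP/eqP.
  by rewrite -submxE.
have hZ : (\rank (Z *m (f *m c)) <= \rank (Z' *m c))%N.
  by rewrite mulmxA; apply/mxrankS/submxMr.
rewrite leq_subLR -(mxrank_mul_ker Z (f *m c)) addnC leq_add //.
apply: leq_trans hZ _; rewrite -(mxrank_mul_ker Z' c) -addnBA //.
exact: leq_addr.
Qed.

End RankDifference.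

Section DiagonalPart.
Variables (k : fieldType) (n : nat).
Local Notation degree := 'rV[int]_n.

(** This is what tensoring with [k] leaves of a homogeneous map: entries between equal degrees are
    constants, all others lie in the ideal of the variables. *)
Definition diagonal_part r c (dr : 'I_r -> degree) (dc : 'I_c -> degree)
    (A : 'M[k]_(r, c)) : 'M[k]_(r, c) :=
  \matrix_(a, b) (if dr a == dc b then A a b else 0).

Definition degree_proj r (dr : 'I_r -> degree) (g : degree) : 'M[k]_r :=
  diag_mx (\row_a (dr a == g)%:R).

(* For entries going down in degree, equality of the outer degrees forces
   equality with the intermediate one. *)
Lemma diagonal_partM r l c (dr : 'I_r -> degree) (dm : 'I_l -> degree)
    (dc : 'I_c -> degree) A B :
  triangular dr dm A -> triangular dm dc B ->
  diagonal_part dr dc (A *m B) = diagonal_part dr dm A *m diagonal_part dm dc B.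
Proof.
move=> tA tB; apply/matrixP => a b; rewrite !mxE.
have [e|ne] := eqVneq (dr a) (dc b); last first.
  rewrite big1 // => j _; rewrite !mxE.
  have [e1|] := eqVneq (dr a) (dm j); last by rewrite mul0r.
  by rewrite -e1 (negbTE ne) mulr0.
apply: eq_bigr => j _; rewrite !mxE.
have [->|/tA aj] := eqVneq (A a j) 0; first by rewrite if_same !mul0r.
have [->|/tB jb] := eqVneq (B j b) 0; first by rewrite if_same !mulr0.
have ej : dr a = dm j by apply: ledeg_anti => //; rewrite e.
by rewrite -ej e !eqxx.
Qed.

Lemma diagonal_partD r c (dr : 'I_r -> degree) (dc : 'I_c -> degree) A B :
  diagonal_part dr dc (A + B) = diagonal_part dr dc A + diagonal_part dr dc B.
Proof. by apply/matrixP => a b; rewrite !mxE; case: eqP; rewrite ?addr0. Qed.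

Lemma diagonal_part1 r (dr : 'I_r -> degree) : diagonal_part dr dr 1%:M = 1%:M.
Proof.
apply/matrixP => a b; rewrite !mxE; have [->|_] := eqVneq a b; first by rewrite eqxx.
by rewrite if_same.
Qed.

Lemma diagonal_part_proj r c (dr : 'I_r -> degree) (dc : 'I_c -> degree) A g :
  degree_proj dr g *m diagonal_part dr dc A =
  diagonal_part dr dc A *m degree_proj dc g.
Proof.
apply/matrixP => a b; rewrite mul_diag_mx mul_mx_diag !mxE.
have [->|_] := eqVneq (dr a) (dc b); last by rewrite mulr0 mul0r.
by rewrite mulrC.
Qed.

Lemma degree_proj_idem r (dr : 'I_r -> degree) g :
  degree_proj dr g *m degree_proj dr g = degree_proj dr g.
Proof.
apply/matrixP => a b; rewrite mul_diag_mx !mxE.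
by case: (dr a == g); rewrite ?mul1r // mul0r mul0rn.
Qed.

End DiagonalPart.

Section Comparison.
Variables (k : fieldType) (n : nat) (J : set {mpoly k[n]}).
Local Notation degree := 'rV[int]_n.
Local Notation resolution := (graded_free_resolution J).
Implicit Types F G : resolution.

Definition scalar_diff F i : 'M[k]_(gf_rank F i.+1, gf_rank F i) :=
  strand_mx (@gf_deg _ _ _ F i.+1) (@gf_deg _ _ _ F i) (gf_diff F i).

Definition scalar_aug F : 'cV[k]_(gf_rank F 0) :=
  strand_mx (@gf_deg _ _ _ F 0) (fun _ => 0) (gf_aug F).

(** At [0] this is the augmentation, whereas [tensor_out] is zero there: lifting takes place in the
    augmented complex, which is exact. *)
Definition scalar_out F i :
    'M[k]_(gf_rank F i, if i is j.+1 then gf_rank F j else 1%N) :=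
  if i is j.+1 then scalar_diff F j else scalar_aug F.

Lemma triangular_diff F i :
  triangular (@gf_deg _ _ _ F i.+1) (@gf_deg _ _ _ F i) (scalar_diff F i).
Proof. exact: triangular_strand. Qed.

Lemma gf_aug_homog0 F a b :
  homogeneous (@gf_deg _ _ _ F 0 a - (fun _ : 'I_1 => 0) b) (gf_aug F a b).
Proof. by rewrite ord1 subr0; apply: gf_aug_homog. Qed.

Lemma scalar_out_diff F i : scalar_diff F i *m scalar_out F i = 0.
Proof.
case: i => [|i] /=.
  rewrite -(strand_mxMr _ _ (@triangular_strand _ _ _ _ _ _ _)).
  rewrite strand_mxK; last exact: gf_aug_homog0.
  have -> : gf_diff F 0 *m gf_aug F = 0; last exact: strand_mx0.
  apply/row_matrixP => a; rewrite row0 row_mul; apply/gf_exact0.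
  by exists (delta_mx 0 a); rewrite rowE.
rewrite -(strand_mxMr _ _ (@triangular_strand _ _ _ _ _ _ _)).
rewrite strand_mxK; last exact: gf_diff_homog.
have -> : gf_diff F i.+1 *m gf_diff F i = 0; last exact: strand_mx0.
apply/row_matrixP => a; rewrite row0 row_mul; apply/gf_exactS.
by exists (delta_mx 0 a); rewrite rowE.
Qed.

Lemma exists_lift F i q (dq : 'I_q -> degree) (U : 'M_(q, gf_rank F i)) :
  triangular dq (@gf_deg _ _ _ F i) U -> U *m scalar_out F i = 0 ->
  exists2 W, triangular dq (@gf_deg _ _ _ F i.+1) W & U = W *m scalar_diff F i.
Proof.
case: i U => [|i] U tU /= UZ.
  apply: (strand_exact (@gf_diff_homog _ _ _ F 0) (@gf_aug_homog0 F) _ tU UZ) => v.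
  by move/gf_exact0.
apply: (strand_exact (@gf_diff_homog _ _ _ F i.+1) (@gf_diff_homog _ _ _ F i)
  _ tU UZ) => v.
by move/gf_exactS.
Qed.

(** Choosing lifts by a total function allows chain maps and homotopies to be defined by plain
    recursion; that a lift exists at each stage is proved afterwards. *)
Definition lift_mx F i q (dq : 'I_q -> degree) (U : 'M_(q, gf_rank F i)) :=
  xget 0 [set W | triangular dq (@gf_deg _ _ _ F i.+1) W
               /\ U = W *m scalar_diff F i]%classic.

Lemma lift_mxP F i q (dq : 'I_q -> degree) (U : 'M_(q, gf_rank F i)) :
  triangular dq (@gf_deg _ _ _ F i) U -> U *m scalar_out F i = 0 ->
  triangular dq (@gf_deg _ _ _ F i.+1) (lift_mx dq U)
  /\ U = lift_mx dq U *m scalar_diff F i.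
Proof.
move=> tU UZ; have [W tW eW] := exists_lift tU UZ.
by apply: (@xgetPex _ _ [set W | triangular dq (@gf_deg _ _ _ F i.+1) W
               /\ U = W *m scalar_diff F i]%classic); exists W.
Qed.

Lemma exists_lift_aug F G :
  exists2 W, triangular (@gf_deg _ _ _ F 0) (@gf_deg _ _ _ G 0) W
           & W *m scalar_aug G = scalar_aug F.
Proof.
have /choice [W hW] : forall a, exists w : 'rV_(gf_rank G 0),
    row a (gf_aug F) = w *m gf_aug G.
  move=> a; have : J (gf_aug F a 0).
    apply/(gf_aug_range F); exists (delta_mx 0 a).
    by rewrite -rowE mxE.
  case/(gf_aug_range G) => w e; exists w; apply/rowP => j.
  by rewrite ord1 mxE e.
exists (strand_mx (@gf_deg _ _ _ F 0) (@gf_deg _ _ _ G 0) (\matrix_a W a)).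
  exact: triangular_strand.
rewrite -(strand_mxMr _ _ (@triangular_strand _ _ _ _ _ _ _)).
rewrite strand_mxK; last exact: gf_aug_homog0.
congr strand_mx; apply/row_matrixP => a.
by rewrite row_mul rowK hW.
Qed.

Record chain_map F G := ChainMap {
  cm_mx : forall i, 'M[k]_(gf_rank F i, gf_rank G i);
  cm_triangular : forall i,
    triangular (@gf_deg _ _ _ F i) (@gf_deg _ _ _ G i) (cm_mx i);
  cm_aug : cm_mx 0 *m scalar_aug G = scalar_aug F;
  cm_comm : forall i, cm_mx i.+1 *m scalar_diff G i = scalar_diff F i *m cm_mx i
}.

Lemma exists_chain_map F G : inhabited (chain_map F G).
Proof.
have [f0 tf0 f0aug] := exists_lift_aug F G.
pose f := fix f i : 'M[k]_(gf_rank F i, gf_rank G i) :=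
  if i is j.+1 then lift_mx (@gf_deg _ _ _ F j.+1) (scalar_diff F j *m f j)
  else f0.
have tD i : triangular (@gf_deg _ _ _ F i) (@gf_deg _ _ _ G i) (f i) ->
    triangular (@gf_deg _ _ _ F i.+1) (@gf_deg _ _ _ G i) (scalar_diff F i *m f i).
  by move=> tf; apply: triangular_mul tf; apply: triangular_diff.
(* The second conjunct is the cycle condition under which the next component can be lifted. *)
have inv i : triangular (@gf_deg _ _ _ F i) (@gf_deg _ _ _ G i) (f i) /\
             scalar_diff F i *m f i *m scalar_out G i = 0.
  elim: i => [|i [tf fZ]].
    by split=> //=; rewrite -mulmxA f0aug (scalar_out_diff F 0).
  have [tl el] := lift_mxP (tD _ tf) fZ; split=> //=.
  by rewrite -mulmxA -el mulmxA (scalar_out_diff F i.+1) mul0mx.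
split; exists f => //= [i|i]; first by have [] := inv i.
by have [tf fZ] := inv i; have [_ <-] := lift_mxP (tD _ tf) fZ.
Qed.

(** Here [e] is a chain endomorphism inducing zero on [J]. Corrected by the part of the homotopy
    already built, each [e i] is killed by the outgoing map and therefore lifts. *)
Lemma exists_null_homotopy F (e : forall i, 'M[k]_(gf_rank F i)) :
  (forall i, triangular (@gf_deg _ _ _ F i) (@gf_deg _ _ _ F i) (e i)) ->
  e 0%N *m scalar_aug F = 0 ->
  (forall i, e i.+1 *m scalar_diff F i = scalar_diff F i *m e i) ->
  exists h : forall i, 'M[k]_(gf_rank F i, gf_rank F i.+1),
  [/\ forall i, triangular (@gf_deg _ _ _ F i) (@gf_deg _ _ _ F i.+1) (h i),
      e 0%N = h 0%N *m scalar_diff F 0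
    & forall i, e i.+1 = scalar_diff F i *m h i + h i.+1 *m scalar_diff F i.+1].
Proof.
move=> te e0 eS.
pose h := fix h i : 'M[k]_(gf_rank F i, gf_rank F i.+1) :=
  if i is j.+1 then lift_mx (@gf_deg _ _ _ F j.+1) (e j.+1 - scalar_diff F j *m h j)
  else lift_mx (@gf_deg _ _ _ F 0) (e 0%N).
have [th0 eh0] := lift_mxP (te 0%N) e0.
have step i : triangular (@gf_deg _ _ _ F i) (@gf_deg _ _ _ F i.+1) (h i) ->
    scalar_diff F i *m (e i - h i *m scalar_diff F i) = 0 ->
    triangular (@gf_deg _ _ _ F i.+1) (@gf_deg _ _ _ F i.+2) (h i.+1) /\
    e i.+1 - scalar_diff F i *m h i = h i.+1 *m scalar_diff F i.+1.
  move=> th hZ; apply: lift_mxP => /=.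
    apply: triangularB => //; apply: triangular_mul th.
    exact: triangular_diff.
  by rewrite mulmxBl eS -mulmxA -mulmxBr.
have inv i : triangular (@gf_deg _ _ _ F i) (@gf_deg _ _ _ F i.+1) (h i) /\
    scalar_diff F i *m (e i - h i *m scalar_diff F i) = 0.
  elim: i => [|i [th hZ]]; first by split=> //; rewrite -eh0 subrr mulmx0.
  have [th' eh'] := step i th hZ; split=> //.
  by rewrite -eh' opprB addrC subrK mulmxA (scalar_out_diff F i.+1) mul0mx.
exists h; split=> // [i|i]; first by have [] := inv i.
by have [th hZ] := inv i; have [_ <-] := step i th hZ; rewrite addrC subrK.
Qed.

Local Notation dpart F i j :=
  (diagonal_part (@gf_deg _ _ _ F i) (@gf_deg _ _ _ F j)).

(** A homogeneous polynomial has a non-zero constant term only in degree [0]. *)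
Lemma tensor_diffE F i :
  tensor_diff F i = dpart F i.+1 i (scalar_diff F i).
Proof.
apply/matrixP => a b; rewrite !mxE.
have hd := @gf_diff_homog _ _ _ F i a b.
have [e|ne] := eqVneq (gf_deg a) (gf_deg b).
  rewrite e subrr /degree_coef ledeg_refl; congr mcoeff.
  by apply/mnmP => j; rewrite !mnmE mxE.
apply/eqP; apply: contraNT ne; rewrite mcoeff_eq0 negbK => /hd e.
by rewrite -subr_eq0 -e; apply/eqP/rowP => j; rewrite !mxE mnmE.
Qed.

Lemma tensor_out_diff F i : tensor_diff F i *m tensor_out F i = 0.
Proof.
case: i => [|i] /=; first by rewrite mulmx0.
rewrite !tensor_diffE -diagonal_partM; [|exact: triangular_diff..].
by rewrite (scalar_out_diff F i.+1); apply/matrixP => a b; rewrite !mxE if_same.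
Qed.

Lemma tor_boundary_sub F i g :
  (tensor_degree F i.+1 g *m tensor_diff F i <=
   tensor_degree F i g :&: kermx (tensor_out F i))%MS.
Proof.
rewrite sub_capmx; apply/andP; split.
  by rewrite tensor_diffE diagonal_part_proj submxMl.
by apply/sub_kermxP; rewrite -mulmxA tensor_out_diff mulmx0.
Qed.

(** Chain maps in both directions compose to a map homotopic to the identity, and diagonal parts
    preserve this relation. Hence a cycle of [F] whose image in [G] is a boundary is itself a
    boundary, which is the injectivity required by [rank_diff_le]. *)
Lemma tor_dim_le F G i g : (tor_dim F i g <= tor_dim G i g)%N.
Proof.
have [f] := exists_chain_map F G; have [f'] := exists_chain_map G F.
pose e j := 1%:M - cm_mx f j *m cm_mx f' j.
have [|||h [th h0 hS]] := @exists_null_homotopy F e.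
- move=> j; apply: triangularB; first exact: triangular1.
  exact: triangular_mul (@cm_triangular _ _ f j) (@cm_triangular _ _ f' j).
- by rewrite mulmxBl mul1mx -mulmxA !cm_aug subrr.
- move=> j; rewrite mulmxBl mulmxBr mul1mx mulmx1 -mulmxA cm_comm.
  by rewrite mulmxA cm_comm mulmxA.
pose fb j := diagonal_part (@gf_deg _ _ _ F j) (@gf_deg _ _ _ G j) (cm_mx f j).
pose fb' j := diagonal_part (@gf_deg _ _ _ G j) (@gf_deg _ _ _ F j) (cm_mx f' j).
have fb_comm j : fb j.+1 *m tensor_diff G j = tensor_diff F j *m fb j.
  rewrite !tensor_diffE -!diagonal_partM; try exact: triangular_diff;
    try exact: cm_triangular.
  by rewrite cm_comm.
have fb'_comm j : fb' j.+1 *m tensor_diff F j = tensor_diff G j *m fb' j.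
  rewrite !tensor_diffE -!diagonal_partM; try exact: triangular_diff;
    try exact: cm_triangular.
  by rewrite cm_comm.
(* On cycles only one homotopy term survives, and it is a boundary; at [i = 0] it is the only term
   from the start. *)
have homot (u : 'rV_(gf_rank F i)) : u *m tensor_out F i = 0 ->
    u = u *m fb i *m fb' i + u *m dpart F i i.+1 (h i) *m tensor_diff F i.
  move=> uZ; have eqe : cm_mx f i *m cm_mx f' i + e i = 1%:M by rewrite addrC subrK.
  rewrite -{1}[u]mulmx1 -(diagonal_part1 _ (@gf_deg _ _ _ F i)) -eqe.
  rewrite diagonal_partD.
  rewrite (diagonal_partM (@cm_triangular _ _ f i) (@cm_triangular _ _ f' i)).
  rewrite mulmxDr !mulmxA; congr (_ + _).
  rewrite tensor_diffE -mulmxA -(diagonal_partM (th i) (@triangular_diff F i)).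
  case: i u uZ {eqe} => [|j] u /= uZ.
    by rewrite h0.
  rewrite hS diagonal_partD (diagonal_partM (@triangular_diff F j) (th j)).
  by rewrite -tensor_diffE mulmxDr mulmxA uZ mul0mx add0r.
have fbZ (u : 'rV_(gf_rank F i)) : u *m tensor_out F i = 0 ->
    u *m fb i *m tensor_out G i = 0.
  case: i u {homot} => [|j] u /= uZ; first by rewrite mulmx0.
  by rewrite -mulmxA fb_comm mulmxA uZ mul0mx.
apply: (@rank_diff_le _ _ _ _ _ _ _ (fb i)).
- apply/rV_subP => v /submxP[c ->]; rewrite mulmxA.
  set u := c *m _; have : (u <= tensor_degree F i g :&: kermx (tensor_out F i))%MS.
    exact: submxMl.
  rewrite !sub_capmx => /andP[ud /sub_kermxP uZ]; apply/andP; split.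
    have /submxP[x ->] := ud.
    by rewrite -mulmxA diagonal_part_proj mulmxA submxMl.
  exact/sub_kermxP/fbZ.
- exact: tor_boundary_sub.
move=> u; rewrite sub_capmx => /andP[/submxP[x eu] /sub_kermxP uZ] /submxP[y ey].
have ug : u = u *m tensor_degree F i g.
  by rewrite eu -mulmxA degree_proj_idem.
rewrite ug (homot u uZ) ey [y *m _]mulmxA -[_ *m fb' i]mulmxA -fb'_comm.
rewrite !mulmxA -mulmxDl -mulmxA tensor_diffE -diagonal_part_proj mulmxA.
by rewrite -mulmxA submxMl.
Qed.

End Comparison.

Lemma graded_bettiE (k : fieldType) (n : nat) (J : set {mpoly k[n]})
    (F : graded_free_resolution J) i g :
  graded_betti J i g = tor_dim F i g.
Proof.
apply: xget_unique; first by exists F.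
by move=> _ [G ->]; apply/eqP; rewrite eqn_leq !tor_dim_le.
Qed.

(** * The resolution supported on an order complex *)

Section FaceProjections.
Variables (k : fieldType) (V : finType).
Local Notation N := #|{: {set V}}|.
Local Notation bdry := (simplicial_boundary k V).
Implicit Types (C D : {set {set V}}) (s : {set V}) (p v : V).

Definition span_proj C : 'M[k]_N := diag_mx (\row_a (subset_of a \in C)%:R).

Lemma face_spaceE K j :
  face_space k K j = span_proj [set s in K | #|s| == j].
Proof. by congr diag_mx; apply/rowP => a; rewrite !mxE inE. Qed.

Lemma span_projMl C r (M : 'M_(N, r)) a b :
  (span_proj C *m M) a b = if subset_of a \in C then M a b else 0.
Proof. by rewrite mul_diag_mx !mxE; case: ifP; rewrite ?mul1r ?mul0r. Qed.

Lemma span_projMr C r (M : 'M_(r, N)) a b :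
  (M *m span_proj C) a b = if subset_of b \in C then M a b else 0.
Proof. by rewrite mul_mx_diag !mxE; case: ifP; rewrite ?mulr1 ?mulr0. Qed.

Lemma span_proj_idem C : span_proj C *m span_proj C = span_proj C.
Proof.
apply/matrixP => a b; rewrite span_projMl; case: ifP => // aC.
by rewrite !mxE aC mul0rn.
Qed.

Lemma boundary_neq0 a b : bdry a b != 0 ->
  exists2 v, v \in subset_of a & subset_of b = subset_of a :\ v.
Proof.
apply: contra_neqP => nex; rewrite mxE big_pred0 // => v.
by apply/negP => /andP[va /eqP e]; case: nex; exists v.
Qed.

Lemma cone_neq0 p a b : cone_mx k p a b != 0 ->
  p \notin subset_of a /\ subset_of b = p |: subset_of a.
Proof. by rewrite mxE; case: ifP => [/andP[? /eqP]//|]; rewrite eqxx. Qed.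

Lemma span_proj_boundary C D :
  (forall s v, s \in C -> v \in s -> s :\ v \in D) ->
  span_proj C *m bdry *m span_proj D = span_proj C *m bdry.
Proof.
move=> CD; apply/matrixP => a b; rewrite span_projMr !span_projMl.
case: (boolP (subset_of a \in C)) => aC; last by rewrite if_same.
have [->|/boundary_neq0[v va ->]] := eqVneq (bdry a b) 0; first by rewrite if_same.
by rewrite CD.
Qed.

Lemma span_proj_cone p C D :
  (forall s, s \in C -> p \notin s -> p |: s \in D) ->
  span_proj C *m cone_mx k p *m span_proj D = span_proj C *m cone_mx k p.
Proof.
move=> CD; apply/matrixP => a b; rewrite span_projMr !span_projMl.
case: (boolP (subset_of a \in C)) => aC; last by rewrite if_same.
have [->|/cone_neq0[pa ->]] := eqVneq (cone_mx k p a b) 0; first by rewrite if_same.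
by rewrite CD.
Qed.

(** This includes the space with basis [C] into the space on all subsets, and its transpose projects
    back: the modules of the resolution have bases of varying size, while boundary and cone act on
    one fixed space. *)
Definition span_basis C : 'M[k]_(#|C|, N) :=
  \matrix_(a, b) (subset_of b == enum_val a)%:R.

Lemma span_basisMtr C r (M : 'M_(r, N)) a b :
  (M *m (span_basis C)^T) a b = M a (enum_rank (enum_val b)).
Proof.
rewrite mxE (bigD1 (enum_rank (enum_val b))) //= !mxE /subset_of enum_rankK eqxx.
rewrite mulr1 big1 ?addr0 // => c; rewrite !mxE -(inj_eq (@enum_val_inj _ _)).
by rewrite enum_rankK => /negbTE ->; rewrite mulr0.
Qed.

Lemma span_basisMl C r (M : 'M_(N, r)) a b :
  (span_basis C *m M) a b = M (enum_rank (enum_val a)) b.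
Proof.
rewrite mxE (bigD1 (enum_rank (enum_val a))) //= !mxE /subset_of enum_rankK eqxx.
rewrite mul1r big1 ?addr0 // => c; rewrite !mxE -(inj_eq (@enum_val_inj _ _)).
by rewrite enum_rankK => /negbTE ->; rewrite mul0r.
Qed.

Lemma span_basis_tr C : span_basis C *m (span_basis C)^T = 1%:M.
Proof.
apply/matrixP => a b; rewrite span_basisMtr !mxE /subset_of enum_rankK.
by rewrite (inj_eq enum_val_inj) eq_sym.
Qed.

Lemma span_tr_basis C : (span_basis C)^T *m span_basis C = span_proj C.
Proof.
apply/matrixP => a b; rewrite !mxE.
have [<-|ab] := eqVneq a b; last first.
  rewrite big1 // => c _; rewrite !mxE.
  case: eqP => [ea|_]; last by rewrite mul0r.
  case: eqP => [eb|_]; last by rewrite mulr0.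
  by rewrite (enum_val_inj (etrans ea (esym eb))) eqxx in ab.
case: (boolP (subset_of a \in C)) => aC; last first.
  rewrite big1 // => c _; rewrite !mxE; case: eqP => [e|_]; last by rewrite mul0r.
  by rewrite e enum_valP in aC.
rewrite (bigD1 (enum_rank_in aC (subset_of a))) //= !mxE enum_rankK_in // eqxx.
rewrite mulr1 big1 ?addr0 // => c; rewrite !mxE -(inj_eq enum_val_inj).
by rewrite enum_rankK_in // eq_sym => /negbTE ->; rewrite mul0r.
Qed.

Lemma span_basis_proj C : span_basis C *m span_proj C = span_basis C.
Proof. by rewrite -span_tr_basis mulmxA span_basis_tr mul1mx. Qed.

End FaceProjections.

(* The matrices [S i] identify, up to sign, the coordinate subspaces [D i] of
   the complex [t] with the coordinate subspaces [P i] of the complex [d]. *)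
Section PartialIsometry.
Variables (k : fieldType) (N : nat) (r : nat -> nat).
Variables (P : nat -> 'M[k]_N) (d : 'M[k]_N).
Variables (D : forall i, 'M[k]_(r i)) (t : forall i, 'M[k]_(r i.+1, r i)).
Variable S : forall i, 'M[k]_(N, r i).
Hypothesis SS : forall i, S i *m (S i)^T = P i.
Hypothesis StS : forall i, (S i)^T *m S i = D i.
Hypothesis Pid : forall i, P i *m P i = P i.
Hypothesis Did : forall i, D i *m D i = D i.
Hypothesis PS : forall i, P i *m S i = S i.
Hypothesis Pd : forall i, P i.+1 *m d *m P i = P i.+1 *m d.
Hypothesis P0d : P 0 *m d = 0.
Hypothesis Dt : forall i, D i.+1 *m t i = t i *m D i.
Hypothesis dd : d *m d = 0.
Hypothesis tt : forall i, t i.+1 *m t i = 0.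
Hypothesis St : forall i, S i.+1 *m t i = - (P i.+1 *m d *m S i).

Let out i : 'M[k]_(r i, r i.-1) :=
  match i return 'M[k]_(r i, r i.-1) with 0 => 0 | j.+1 => t j end.

Let SD i : S i *m D i = S i.
Proof. by rewrite -StS mulmxA SS PS. Qed.

Let DSt i : D i *m (S i)^T = (S i)^T.
Proof.
have PT : (P i)^T = P i by rewrite -SS trmx_mul trmxK.
by rewrite -StS -mulmxA SS -PT -trmx_mul PS.
Qed.

(** [S i] and its transpose are inverse to each other on the two coordinate subspaces and commute
    with the differentials up to sign, so [rank_diff_le] applies in both directions. At [i = 0],
    where [out] is zero, the cycle condition in the complex [d] comes from [P0d]. *)
Lemma partial_isometry_rank i :
  (\rank (D i :&: kermx (out i))%MS - \rank (D i.+1 *m t i) =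
   \rank (P i :&: kermx d)%MS - \rank (P i.+1 *m d))%N.
Proof.
have Pker (u : 'rV_N) : (u <= P i :&: kermx d)%MS -> u *m P i = u /\ u *m d = 0.
  rewrite sub_capmx => /andP[/submxP[x ->] /sub_kermxP ud].
  by rewrite -mulmxA Pid.
have Dker (u : 'rV_(r i)) : (u <= D i :&: kermx (out i))%MS ->
    u *m D i = u /\ u *m out i = 0.
  rewrite sub_capmx => /andP[/submxP[x ->] /sub_kermxP ud].
  by rewrite -mulmxA Did.
have StP j : (S j)^T *m P j = (S j)^T by rewrite -SS mulmxA StS DSt.
apply/eqP; rewrite eqn_leq; apply/andP; split.
- have SZ (u : 'rV_(r i)) : u *m D i = u -> u *m out i = 0 ->
      u *m (S i)^T *m d = 0.
    rewrite /out; case: (i) u => [|j] u ud uo.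
      by rewrite -StP -!mulmxA P0d !mulmx0.
    have e : (S j.+1)^T *m d = - (D j.+1 *m t j *m (S j)^T).
      rewrite -StP -mulmxA -Pd -(SS j) -StS -[(S _)^T *m S _ *m t j]mulmxA St.
      by rewrite mulmxN mulNmx opprK !mulmxA.
    by rewrite -mulmxA e mulmxN !mulmxA ud uo mul0mx oppr0.
  apply: (@rank_diff_le _ _ _ _ _ _ _ (S i)^T).
  + apply/rV_subP => v /submxP[c ->]; rewrite mulmxA.
    set u := c *m _; have [ud uo] := Dker u (submxMl _ _).
    rewrite sub_capmx -{1}StP mulmxA submxMl /=; apply/sub_kermxP.
    exact: SZ.
  + rewrite sub_capmx -{1}Pd submxMl /=; apply/sub_kermxP.
    by rewrite -mulmxA dd mulmx0.
  move=> u /Dker[ud uo] /submxP[y ey].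
  rewrite -ud -StS mulmxA ey -mulmxA -[_ *m d *m S i]opprK -St mulmxN.
  rewrite -[S i.+1]SD -!mulmxA [y *m _]mulmxA -mulNmx.
  exact: submxMl.
have SZ (u : 'rV_N) : u *m P i = u -> u *m d = 0 -> u *m S i *m out i = 0.
  rewrite /out; case: (i) => [|j] uP ud; first by rewrite mulmx0.
  by rewrite -mulmxA St mulmxN !mulmxA uP ud mul0mx oppr0.
apply: (@rank_diff_le _ _ _ _ _ _ _ (S i)).
- apply/rV_subP => v /submxP[c ->]; rewrite mulmxA.
  set u := c *m _; have [uP ud] := Pker u (submxMl _ _).
  rewrite sub_capmx -{1}SD mulmxA submxMl /=; apply/sub_kermxP.
  exact: SZ.
- rewrite sub_capmx Dt submxMl /=; apply/sub_kermxP; rewrite -Dt -mulmxA /out.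
  by case: (i) => [|j]; rewrite ?tt !mulmx0.
move=> u /Pker[uP ud] /submxP[y ey].
rewrite -uP -SS mulmxA ey -StS -[_ *m S i.+1 *m t i]mulmxA St.
rewrite !(mulmxN, mulNmx) -!mulmxA SS [P i.+1 *m (d *m P i)]mulmxA Pd.
rewrite [y *m _]mulmxA -mulNmx; exact: submxMl.
Qed.

End PartialIsometry.

Section OrderComplexResolution.
Variables (k : fieldType) (n : nat) (V : finType) (lt : rel V).
Variable lab : V -> {set 'I_n}.
Local Notation R := {mpoly k[n]}.
Local Notation N := #|{: {set V}}|.
Local Notation bdry := (simplicial_boundary k V).
Implicit Types (s : {set V}) (p q u v : V) (B : {set 'I_n}).

Definition set_degree B : 'rV[int]_n := \row_j (j \in B)%:R.

Definition is_chain s : bool :=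
  [forall q in s, forall q' in s, [|| q == q', lt q q' | lt q' q]].

(* Indexed by the number of vertices: [chains i] are the simplices of dimension
   [i - 1], and [chains i.+1] is the basis of the [i]-th module below. *)
Definition chains i : {set {set V}} := [set s | is_chain s & #|s| == i].

Definition chain_label s : {set 'I_n} := (\bigcup_(v in s) lab v)%SET.

Definition chain_degree i (a : 'I_#|chains i|) : 'rV[int]_n :=
  set_degree (chain_label (enum_val a)).

Local Notation basis i := (span_basis k (chains i)).

Definition chain_diff i : 'M[k]_(#|chains i.+1|, #|chains i|) :=
  basis i.+1 *m bdry *m (basis i)^T.

Definition chain_aug : 'cV[k]_#|chains 1| :=
  basis 1 *m bdry *m (set_row k finset.set0)^T.

Lemma is_chainP s :
  reflect {in s &, forall q q', [|| q == q', lt q q' | lt q' q]} (is_chain s).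
Proof.
apply: (iffP forall_inP) => [h q q' qs q's|h q qs].
  by have /forall_inP/(_ q' q's) := h q qs.
by apply/forall_inP => q' q's; apply: h.
Qed.

Lemma is_chainS s s' : s' \subset s -> is_chain s -> is_chain s'.
Proof.
move=> /fintype.subsetP ss /is_chainP h; apply/is_chainP => q q' /ss qs /ss.
exact: h.
Qed.

Lemma chainsD1 i s v : s \in chains i.+1 -> v \in s -> s :\ v \in chains i.
Proof.
rewrite !inE (cardsD1 v) => /andP[sc es] vs; apply/andP; split.
  exact: is_chainS (finset.subD1set _ _) sc.
by rewrite vs in es.
Qed.

Lemma chain_proj_boundary i :
  basis i.+1 *m bdry *m span_proj k (chains i) = basis i.+1 *m bdry.
Proof.
rewrite -span_basis_proj -!mulmxA; congr (_ *m _).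
by rewrite mulmxA span_proj_boundary //; apply: chainsD1.
Qed.

Lemma set_degree_le B1 B2 : ledeg (set_degree B1) (set_degree B2) = (B1 \subset B2).
Proof.
apply/ledegP/fintype.subsetP => h j; last first.
  by rewrite !mxE; have := h j; do 2!case: (_ \in _) => // /(_ isT).
by move=> jB; have := h j; rewrite !mxE jB; case: (_ \in _).
Qed.

Lemma set_degree_ge0 B : ledeg 0 (set_degree B).
Proof. by apply/ledegP => j; rewrite !mxE; case: (_ \in _). Qed.

Lemma set_degree_inj : injective set_degree.
Proof.
move=> B1 B2 e; apply/eqP; rewrite finset.eqEsubset -!set_degree_le e.
by rewrite ledeg_refl.
Qed.

Lemma chain_labelS s s' : s \subset s' -> chain_label s \subset chain_label s'.
Proof.
move=> ss; apply/finset.bigcupsP => v vs.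
exact/finset.bigcup_sup/(fintype.subsetP ss).
Qed.

Lemma triangular_chain_diff i :
  triangular (@chain_degree i.+1) (@chain_degree i) (chain_diff i).
Proof.
move=> a b; rewrite span_basisMtr span_basisMl => /boundary_neq0[v _].
rewrite /subset_of !enum_rankK /chain_degree set_degree_le => ->.
exact/chain_labelS/finset.subD1set.
Qed.

(** In the arrangement, going up in [P(X)] shrinks the label, and [lab_top] is witnessed by the
    union of all minimal covers inside [B]. *)
Hypothesis ltE : forall p q, lt p q = (lab q \proper lab p).
Hypothesis lab_inj : injective lab.
Hypothesis lab_top : forall B v, lab v \subset B ->
  exists2 p, lab p \subset B & forall u, lab u \subset B -> lab u \subset lab p.

Lemma chain_labelE s q : q \in s -> (forall u, u \in s -> lab u \subset lab q) ->
  chain_label s = lab q.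
Proof.
move=> qs h; apply/eqP; rewrite finset.eqEsubset; apply/andP; split.
  exact/finset.bigcupsP.
exact: finset.bigcup_sup.
Qed.

(** In a chain the label with the most elements contains all the others; it belongs to the smallest
    element of the chain. *)
Lemma chain_top s : is_chain s -> s != finset.set0 ->
  exists2 q, q \in s & chain_label s = lab q.
Proof.
move=> /is_chainP sc /finset.set0Pn[q0 q0s].
have [q qs qmax] := @arg_maxnP _ q0 (mem s) (fun v => #|lab v|) q0s.
exists q => //; apply: chain_labelE => // u us.
have := sc u q us qs; rewrite !ltE => /or3P[/eqP->//|qu|]; last exact: proper_sub.
have := qmax u us; rewrite /= leqNgt => /negP[].
exact: proper_card.
Qed.

Lemma chain_label_mem s p : is_chain s -> s != finset.set0 ->
  chain_label s = lab p -> p \in s.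
Proof.
by move=> sc s0 e; have [q qs] := chain_top sc s0; rewrite e => /lab_inj->.
Qed.

Lemma chainsU1 i s p : s \in chains i -> p \notin s ->
  (forall u, u \in s -> lab u \subset lab p) -> p |: s \in chains i.+1.
Proof.
rewrite !inE => /andP[/is_chainP sc /eqP es] ps h.
rewrite cardsU1 ps es eqxx andbT; apply/is_chainP.
have cmp q : q \in s -> (q == p) || lt p q.
  move=> qs; rewrite ltE finset.properEneq h // andbT (inj_eq lab_inj).
  by rewrite orbN.
move=> q q'; rewrite !inE => /orP[/eqP->|qs] /orP[/eqP->|q's].
- by rewrite eqxx.
- by have /orP[/eqP->|->] := cmp _ q's; rewrite ?eqxx ?orbT.
- by have /orP[/eqP->|->] := cmp _ qs; rewrite ?eqxx ?orbT.
- exact: sc.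
Qed.

Lemma chains_gt0 i s : s \in chains i.+1 -> s != finset.set0.
Proof. by rewrite inE -card_gt0 => /andP[_ /eqP->]. Qed.

Lemma chain_diff_diff i : chain_diff i.+1 *m chain_diff i = 0.
Proof.
rewrite /chain_diff -!mulmxA [(basis i.+1)^T *m _]mulmxA span_tr_basis.
rewrite !mulmxA chain_proj_boundary -[_ *m bdry *m bdry]mulmxA.
by rewrite boundary_boundary mulmx0 mul0mx.
Qed.

Lemma chain_diff_aug : chain_diff 1 *m chain_aug = 0.
Proof.
rewrite /chain_diff /chain_aug -!mulmxA [(basis 1)^T *m _]mulmxA span_tr_basis.
rewrite !mulmxA chain_proj_boundary -[_ *m bdry *m bdry]mulmxA.
by rewrite boundary_boundary mulmx0 mul0mx.
Qed.

Lemma cell1 (a : 'I_#|chains 1|) : exists v, enum_val a = [set v].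
Proof. by have := enum_valP a; rewrite inE => /andP[_ /cards1P]. Qed.

Lemma mulmx_set_rowE r (M : 'M[k]_(r, N)) s a :
  (M *m (set_row k s)^T) a 0 = M a (enum_rank s).
Proof. by rewrite /set_row trmx_delta -colE mxE. Qed.

Lemma chain_augE a : chain_aug a 0 = 1.
Proof.
have [v ea] := cell1 a.
rewrite mulmx_set_rowE span_basisMl mxE /subset_of !enum_rankK ea.
rewrite (bigD1 v) /= ?inE ?eqxx ?setDv //=; last by rewrite finset.setDv.
rewrite big1 ?addr0 => [|u]; last first.
  by rewrite inE -andbA => /and3P[/eqP-> _]; rewrite eqxx.
rewrite /face_sign (_ : #|_| = 0%N) //; apply: eq_card0 => u.
by rewrite !inE; case: eqP => // ->; rewrite ltnn.
Qed.

(** The entries of a squarefree degree are [0] or [1], so only the places where [b] is positive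
    matter. *)
Lemma set_degree_le_trunc B (b : 'rV[int]_n) : ledeg 0 b ->
  ledeg (set_degree B) b = (B \subset [set j | 1 <= b 0 j]).
Proof.
move=> /ledegP b0; apply/ledegP/fintype.subsetP => h j.
  by move=> jB; have := h j; rewrite !mxE jB inE.
have := b0 j; rewrite !mxE; case: (boolP (j \in B)) => // /h.
by rewrite inE.
Qed.

(* The strand in degree [b] is the augmented complex of a cone: its chains can
   be extended by the element with the largest label below [b]. *)
Lemma chain_strand_acyclic i (b : 'rV[int]_n) (u : 'rV_#|chains i.+1|) :
  triangular (fun _ => b) (@chain_degree i.+1) u ->
  u *m basis i.+1 *m bdry = 0 ->
  exists2 w : 'rV_#|chains i.+2|, triangular (fun _ => b) (@chain_degree i.+2) w
    & u = w *m chain_diff i.+1.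
Proof.
(* A non-zero entry of [u] provides a chain in degree at most [b], hence a label from which
   [lab_top] produces the cone point. *)
move=> tu uZ; have [->|/rV0Pn[a0 ua0]] := eqVneq u 0.
  by exists 0; rewrite ?mul0mx // => x y; rewrite mxE eqxx.
have b0 : ledeg 0 b by apply: ledeg_trans (tu _ _ ua0); apply: set_degree_ge0.
pose B : {set 'I_n} := [set j | 1 <= b 0 j].
have degB j (a : 'I_#|chains j|) :
    ledeg (chain_degree a) b = (chain_label (enum_val a) \subset B).
  exact: set_degree_le_trunc.
have /finset.set0Pn[v0 v0s] := chains_gt0 (enum_valP a0).
have v0B : lab v0 \subset B.
  by have := tu _ _ ua0; rewrite degB => /finset.bigcupsP/(_ v0 v0s).
have [p pB ptop] := lab_top v0B.
pose C j := [set s in chains j | chain_label s \subset B].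
have uC : u *m basis i.+1 *m span_proj k (C i.+1) = u *m basis i.+1.
  rewrite -mulmxA; apply/rowP => c; rewrite !mxE; apply: eq_bigr => a _.
  have [->|/tu] := eqVneq (u 0 a) 0; first by rewrite !mul0r.
  rewrite degB => aB; rewrite span_projMr !mxE.
  case: eqP => [->|_]; last by rewrite if_same.
  by rewrite inE enum_valP aB.
have HC : span_proj k (C i.+1) *m cone_mx k p *m span_proj k (C i.+2) =
          span_proj k (C i.+1) *m cone_mx k p.
  apply: span_proj_cone => s /finset.setIdP[sc sB] ps.
  have sp v : v \in s -> lab v \subset lab p.
    by move=> vs; apply: ptop; have /finset.bigcupsP := sB; apply.
  apply/finset.setIdP; split; first exact: chainsU1.
  by rewrite /chain_label finset.bigcup_setU big_set1 finset.subUset pB.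
pose x := u *m basis i.+1 *m cone_mx k p.
have xC : x *m span_proj k (C i.+2) = x.
  by rewrite /x -uC -!mulmxA [_ *m (_ *m span_proj _ _)]mulmxA HC.
exists (x *m (basis i.+2)^T) => [y a|].
  rewrite degB span_basisMtr -xC span_projMr /subset_of enum_rankK inE.
  by case: ifP => [/andP[]//|]; rewrite eqxx.
rewrite /chain_diff -!mulmxA [(basis i.+2)^T *m _]mulmxA span_tr_basis.
have xchain : x *m span_proj k (chains i.+2) = x.
  rewrite -xC; apply/rowP => c; rewrite !span_projMr.
  by case: (boolP (_ \in C i.+2)) => [/finset.setIdP[-> _]//|_]; rewrite if_same.
rewrite !mulmxA -/x xchain /x -[_ *m cone_mx k p *m bdry]mulmxA.
(* As [u] has zero boundary, the boundary of its cone is [u] itself. *)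
have -> : cone_mx k p *m bdry = 1%:M - bdry *m cone_mx k p.
  by rewrite -(boundary_cone k p) addrAC subrr add0r.
by rewrite mulmxBr mulmx1 mulmxA uZ mul0mx subr0 -mulmxA span_basis_tr mulmx1.
Qed.

Lemma chain_exact i (b : 'rV[int]_n) (u : 'rV_#|chains i.+2|) :
  triangular (fun _ => b) (@chain_degree i.+2) u -> u *m chain_diff i.+1 = 0 ->
  exists2 w : 'rV_#|chains i.+3|, triangular (fun _ => b) (@chain_degree i.+3) w
    & u = w *m chain_diff i.+2.
Proof.
move=> tu uZ; apply: chain_strand_acyclic => //.
rewrite -mulmxA -chain_proj_boundary -span_tr_basis [basis i.+2 *m bdry *m _]mulmxA.
by rewrite -/(chain_diff _) [u *m _]mulmxA uZ mul0mx.
Qed.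

Lemma chain_exact_aug (b : 'rV[int]_n) (u : 'rV_#|chains 1|) :
  triangular (fun _ => b) (@chain_degree 1) u -> u *m chain_aug = 0 ->
  exists2 w : 'rV_#|chains 2|, triangular (fun _ => b) (@chain_degree 2) w
    & u = w *m chain_diff 1.
Proof.
move=> tu uZ; apply: chain_strand_acyclic => //.
rewrite -mulmxA -chain_proj_boundary mulmxA; apply/rowP => c.
rewrite span_projMr [RHS]mxE; case: ifP => // cs.
(* The empty set is the only chain without vertices, so vanishing of the augmentation is vanishing
   of the whole boundary. *)
have -> : c = enum_rank finset.set0.
  apply/enum_val_inj; rewrite enum_rankK; apply/eqP.
  by move: cs; rewrite inE cards_eq0 => /andP[].
have /colP/(_ 0) := uZ; rewrite /chain_aug mulmxA mulmx_set_rowE => ->.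
by rewrite mxE.
Qed.

Lemma sqfreeE B : sqfree k B = degree_monomial k (set_degree B).
Proof.
rewrite /degree_monomial set_degree_ge0 mpolyXE_id /sqfree big_mkcond /=.
by apply: eq_bigr => j _; rewrite mnmE mxE; case: (_ \in _).
Qed.

Section Resolution.
Variable J : set R.
Hypothesis JE : J = ideal_gen [set f | exists v, f = sqfree k (lab v)]%classic.

Definition chain_diff_mx i : 'M[R]_(#|chains i.+2|, #|chains i.+1|) :=
  homog_mx (@chain_degree i.+2) (@chain_degree i.+1) (chain_diff i.+1).

Definition chain_aug_mx : 'cV[R]_#|chains 1| :=
  homog_mx (@chain_degree 1) (fun _ => 0) chain_aug.

Lemma triangular_chain_aug : triangular (@chain_degree 1) (fun _ : 'I_1 => 0) chain_aug.
Proof. by move=> a b _; apply: set_degree_ge0. Qed.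

Lemma chain_diff_homog i a b :
  homogeneous (chain_degree a - chain_degree b) (chain_diff_mx i a b).
Proof. by rewrite mxE; apply: homogeneous_monomial. Qed.

Lemma chain_aug_homog a : homogeneous (chain_degree a) (chain_aug_mx a 0).
Proof. by rewrite mxE subr0; apply: homogeneous_monomial. Qed.

Lemma chain_mx_exact0 (v : 'rV_#|chains 1|) :
  v *m chain_aug_mx = 0 <-> exists w, v = w *m chain_diff_mx 0.
Proof.
apply: homog_exact chain_diff_aug _ v.
- exact: triangular_chain_diff.
- exact: triangular_chain_aug.
- exact: chain_exact_aug.
Qed.

Lemma chain_mx_exactS i (v : 'rV_#|chains i.+2|) :
  v *m chain_diff_mx i = 0 <-> exists w, v = w *m chain_diff_mx i.+1.
Proof.
apply: homog_exact (chain_diff_diff _) _ v.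
- exact: triangular_chain_diff.
- exact: triangular_chain_diff.
- exact: chain_exact.
Qed.

Lemma chain_aug_mxE a v : enum_val a = [set v] -> chain_aug_mx a 0 = sqfree k (lab v).
Proof.
move=> ea; rewrite mxE chain_augE scale1r subr0 sqfreeE; congr degree_monomial.
by rewrite /chain_degree /chain_label ea big_set1.
Qed.

Lemma chain_aug_range f :
  J f <-> exists w : 'rV_#|chains 1|, f = (w *m chain_aug_mx) 0 0.
Proof.
pose X : set R :=
  [set f | exists w : 'rV_#|chains 1|, f = (w *m chain_aug_mx) 0 0]%classic.
rewrite JE; split=> [Jf|[v ->]].
  have idX : is_ideal X.
    split=> [|_ _ [v ->] [w ->]|x _ [v ->]].
    - by exists 0; rewrite mul0mx mxE.
    - by exists (v + w); rewrite mulmxDl [RHS]mxE.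
    - by exists (x *: v); rewrite -scalemxAl [RHS]mxE.
  apply: (smallest_sub idX _ Jf) => _ [v ->].
  have vc : [set v] \in chains 1.
    rewrite inE cards1 eqxx andbT; apply/is_chainP => q q'.
    by rewrite !inE => /eqP-> /eqP->; rewrite eqxx.
  exists (delta_mx 0 (enum_rank_in vc [set v])).
  by rewrite -rowE [RHS]mxE (@chain_aug_mxE _ v) // enum_rankK_in.
rewrite mxE => L [[L0 LD LM] LG]; apply: big_ind => // a _; apply: LM.
by have [u ea] := cell1 a; rewrite (chain_aug_mxE ea); apply: LG; exists u.
Qed.

Definition chain_resolution : graded_free_resolution J :=
  GradedFreeResolution chain_diff_homog chain_aug_homog chain_aug_range
    chain_mx_exact0 chain_mx_exactS.

Lemma scalar_diff_chain i : scalar_diff chain_resolution i = chain_diff i.+1.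
Proof. exact/homog_mxK/triangular_chain_diff. Qed.

Lemma tor_dim_chain_eq0 A i : (forall p, lab p != A) ->
  tor_dim chain_resolution i (set_degree A) = 0%N.
Proof.
move=> nA; rewrite /tor_dim.
have -> : tensor_degree chain_resolution i (set_degree A) = 0.
  apply/matrixP => a b; rewrite !mxE.
  suff /negbTE -> : chain_degree a != set_degree A by rewrite mul0rn.
  have sc := enum_valP a; have s_chain : is_chain (enum_val a).
    by move: sc; rewrite inE => /andP[].
  have [q _ qe] := chain_top s_chain (chains_gt0 sc).
  by rewrite (inj_eq set_degree_inj) qe.
by rewrite cap0mx mxrank0.
Qed.

Section TorDegree.
Variable p : V.
Local Notation K := (order_complex_above lt p).
Let Kf i : {set {set V}} := [set s in K | #|s| == i].
(** Adjoins [p] as new smallest element to a chain above it, with the sign of [cone_mx]. *)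
Let iso i : 'M[k]_(N, #|chains i.+1|) :=
  span_proj k (Kf i) *m cone_mx k p *m (basis i.+1)^T.
Let D i := degree_proj k (@chain_degree i.+1) (set_degree (lab p)).

Let Kf_label i s u : s \in Kf i -> u \in s -> lab u \proper lab p.
Proof. by rewrite !inE => /andP[/andP[/forall_inP h _] _] /h; rewrite ltE. Qed.

Let Kf_notin i s : s \in Kf i -> p \notin s.
Proof. by move=> /Kf_label h; apply/negP => /h; rewrite fintype.properxx. Qed.

Let Kf_chain i s : s \in Kf i -> s \in chains i.
Proof. by rewrite !inE /is_chain => /andP[/andP[_ ->] ->]. Qed.

Let Kf_cone i s : s \in Kf i -> p \notin s -> p |: s \in chains i.+1.
Proof.
move=> sK ps; apply: chainsU1 ps _; first exact: Kf_chain.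
by move=> u /(Kf_label sK)/proper_sub.
Qed.

Let Kf_cone_label i s : s \in Kf i -> chain_label (p |: s) = lab p.
Proof.
move=> sK; apply: chain_labelE; rewrite ?setU11 // => u.
by rewrite !inE => /orP[/eqP->//|/(Kf_label sK)/proper_sub].
Qed.

Let chains_Kf i s : s \in chains i.+1 -> chain_label s = lab p ->
  p \in s /\ s :\ p \in Kf i.
Proof.
move=> sc es; have ps : p \in s.
  by apply: chain_label_mem es; [move: sc; rewrite inE => /andP[]|exact: chains_gt0 sc].
split=> //; have := chainsD1 sc ps.
rewrite !inE /is_chain => /andP[spc ->]; rewrite andbT.
apply/andP; split=> //; apply/forall_inP => u; rewrite !inE => /andP[up us].
rewrite ltE finset.properEneq (inj_eq lab_inj) up -es.
exact: finset.bigcup_sup.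
Qed.

Let KfD1 i s v : s \in Kf i.+1 -> v \in s -> s :\ v \in Kf i.
Proof.
move=> sK vs; have := chainsD1 (Kf_chain sK) vs.
rewrite !inE /is_chain => /andP[-> ->]; rewrite !andbT; apply/forall_inP => u.
by rewrite !inE ltE => /andP[_ /(Kf_label sK)].
Qed.

Let isoE i b a : iso i b a =
  if (subset_of b \in Kf i) && (enum_val a == p |: subset_of b)
  then face_sign k (p |: subset_of b) p else 0.
Proof.
rewrite span_basisMtr span_projMl mxE /subset_of enum_rankK.
by case: (boolP (_ \in Kf i)) => //= /Kf_notin ->.
Qed.

(** The chains labelled [lab p] are the sets [p |: s] with [s] a face of [K]. The [i]-th module has
    chains with [i.+1] vertices as basis, which leaves [i] vertices for [s], that is, dimension
    [i - 1]. The identification is [iso], and most goals below are the hypotheses of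
    [partial_isometry_rank]. *)
Lemma tor_dim_chain i :
  tor_dim chain_resolution i (set_degree (lab p)) =
  reduced_homology_dim k K (i%:Z - 1).
Proof.
rewrite /reduced_homology_dim subrK !face_spaceE.
apply: (@partial_isometry_rank k N (gf_rank chain_resolution)
  (fun i => span_proj k (Kf i)) bdry D (tensor_diff chain_resolution) iso) => {i}.
- move=> i; apply/matrixP => b c; rewrite !mxE.
  have [<-|bc] := eqVneq b c; last first.
    rewrite big1 // => a _; rewrite [_^T _ _]mxE !isoE.
    case: ifP => [/andP[bK /eqP eb]|]; last by rewrite mul0r.
    case: ifP => [/andP[cK /eqP ec]|]; last by rewrite mulr0.
    case/eqP: bc; apply: enum_val_inj; rewrite -!/(subset_of _).
    by rewrite -(finset.setU1K (Kf_notin bK)) -eb ec finset.setU1K // (Kf_notin cK).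
  case: (boolP (subset_of b \in Kf i)) => bK; last first.
    by rewrite big1 // => a _; rewrite [_^T _ _]mxE !isoE (negbTE bK) mul0r.
  have pc := Kf_cone bK (Kf_notin bK).
  rewrite (bigD1 (enum_rank_in pc (p |: subset_of b))) //= [_^T _ _]mxE !isoE bK.
  rewrite enum_rankK_in // eqxx face_sign_sqr big1 ?addr0 // => a.
  rewrite [_^T _ _]mxE !isoE bK -(inj_eq enum_val_inj) enum_rankK_in // => /negbTE ->.
  by rewrite mul0r.
- move=> i; apply/matrixP => a c; rewrite !mxE.
  have [<-|ac] := eqVneq a c; last first.
    rewrite big1 // => b _; rewrite [_^T _ _]mxE !isoE.
    case: ifP => [/andP[_ /eqP ea]|]; last by rewrite mul0r.
    case: ifP => [/andP[_ /eqP ec]|]; last by rewrite mulr0.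
    by case/eqP: ac; apply: enum_val_inj; rewrite ea ec.
  rewrite (inj_eq set_degree_inj); case: eqP => [ea|nea]; last first.
    rewrite big1 // => b _; rewrite [_^T _ _]mxE !isoE.
    case: ifP => [/andP[bK /eqP ea]|]; last by rewrite mul0r.
    by case: nea; rewrite ea (Kf_cone_label bK).
  have [pa aK] := chains_Kf (enum_valP a) ea.
  rewrite (bigD1 (enum_rank (enum_val a :\ p))) //= [_^T _ _]mxE !isoE /subset_of.
  rewrite enum_rankK aK finset.setD1K // eqxx face_sign_sqr big1 ?addr0 // => b.
  rewrite [_^T _ _]mxE !isoE -(inj_eq enum_val_inj) enum_rankK => nb.
  case: ifP => [/andP[bK /eqP eb]|]; last by rewrite mul0r.
  by rewrite eb finset.setU1K ?eqxx // (Kf_notin bK) in nb.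
- by move=> i; apply: span_proj_idem.
- by move=> i; apply: degree_proj_idem.
- by move=> i; rewrite /iso !mulmxA span_proj_idem.
- by move=> i; apply: span_proj_boundary; apply: KfD1.
- apply/matrixP => a b; rewrite span_projMl [RHS]mxE; case: ifP => // aK.
  apply/eqP; apply/negP => /negP/boundary_neq0[v].
  by move: aK; rewrite !inE cards_eq0 => /andP[_ /eqP->]; rewrite inE.
- by move=> i; rewrite tensor_diffE diagonal_part_proj.
- exact: boundary_boundary.
- by move=> i; have := tensor_out_diff chain_resolution i.+1.
move=> i.
have isoD j : iso j *m D j = iso j.
  apply/matrixP => b a; rewrite mul_mx_diag mxE [(\row_ _ _) _ _]mxE isoE.
  case: ifP => [/andP[bK /eqP ea]|]; last by rewrite mul0r.
  by rewrite /chain_degree ea (Kf_cone_label bK) eqxx mulr1.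
have dpartD : D i.+1 *m tensor_diff chain_resolution i =
              D i.+1 *m chain_diff i.+1 *m D i.
  rewrite tensor_diffE scalar_diff_chain; apply/matrixP => a b.
  change (@gf_deg _ _ _ chain_resolution i.+1) with (@chain_degree i.+2).
  change (@gf_deg _ _ _ chain_resolution i) with (@chain_degree i.+1).
  rewrite mul_mx_diag !mul_diag_mx !mxE.
  have [ea|_] := eqVneq (chain_degree a) (set_degree (lab p)); last by rewrite !mul0r.
  by rewrite ea eq_sym !mul1r; case: eqP; rewrite ?mulr1 ?mulr0.
transitivity (iso i.+1 *m (D i.+1 *m chain_diff i.+1 *m D i)).
  by rewrite -dpartD mulmxA isoD.
rewrite !mulmxA isoD.
have isoB j : iso j *m basis j.+1 = span_proj k (Kf j) *m cone_mx k p.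
  rewrite /iso -[_ *m _^T *m _]mulmxA span_tr_basis span_proj_cone // => s sK ps.
  exact: Kf_cone sK ps.
rewrite /chain_diff ?mulmxA isoB -[_ *m cone_mx k p *m bdry]mulmxA.
have -> : cone_mx k p *m bdry = 1%:M - bdry *m cone_mx k p.
  by rewrite -(boundary_cone k p) addrAC subrr add0r.
rewrite mulmxBr mulmx1 !mulmxBl.
(* The identity term of the homotopy formula consists of chains without [p]; their label differs
   from [lab p], so [D i] kills them. *)
have -> : span_proj k (Kf i.+1) *m (basis i.+1)^T *m D i = 0.
  apply/matrixP => b a; rewrite mul_mx_diag mxE [(\row_ _ _) _ _]mxE [RHS]mxE.
  rewrite span_basisMtr !mxE /subset_of.
  case: (boolP (_ \in Kf _)) => [bK|]; last by rewrite mul0rn mul0r.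
  case: eqP => [eb|]; last by rewrite mul0r.
  case: eqP => [/set_degree_inj ea|]; last by rewrite mulr0.
  have [pa _] := chains_Kf (enum_valP a) ea.
  by have := Kf_notin bK; rewrite eb enum_rankK pa.
rewrite sub0r; congr (- _).
have <- : span_proj k (Kf i.+1) *m bdry *m (iso i *m D i) =
    span_proj k (Kf i.+1) *m bdry *m span_proj k (Kf i) *m cone_mx k p
      *m (basis i.+1)^T.
  by rewrite isoD /iso !mulmxA.
by rewrite /iso !mulmxA span_proj_boundary //; apply: KfD1.
Qed.

End TorDegree.

End Resolution.

End OrderComplexResolution.

(** * Heights of coordinate primes *)

Section KrullDimension.
Variables (k : fieldType) (n : nat).
Local Notation R := {mpoly k[n]}.
Implicit Types (P Q : set R) (f g : R).

(** Linear independence over [k] of the classes of the [g t] in [R / P]. *)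
Definition independent_mod (T : finType) (g : T -> R) P : Prop :=
  forall c : T -> k, P (\sum_t c t *: g t) -> forall t, c t = 0.

Definition degree_bounded f (M : nat) : Prop :=
  forall m, m \in msupp f -> (mdeg m <= M)%N.

Lemma ideal0 P : is_ideal P -> P 0. Proof. by case. Qed.

Lemma idealD P f g : is_ideal P -> P f -> P g -> P (f + g).
Proof. by case=> _ h _; apply: h. Qed.

Lemma idealMl P f g : is_ideal P -> P g -> P (f * g).
Proof. by case=> _ _; apply. Qed.

Lemma idealMr P f g : is_ideal P -> P f -> P (f * g).
Proof. by rewrite mulrC; apply: idealMl. Qed.

Lemma idealN P f : is_ideal P -> P f -> P (- f).
Proof. by rewrite -mulN1r; apply: idealMl. Qed.

Lemma idealZ P c f : is_ideal P -> P f -> P (c *: f).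
Proof. by rewrite -mul_mpolyC; apply: idealMl. Qed.

Lemma degree_boundedM f g M1 M2 :
  degree_bounded f M1 -> degree_bounded g M2 -> degree_bounded (f * g) (M1 + M2).
Proof.
move=> hf hg m /msuppM_le /allpairsP[[m1 m2] /= [/hf h1 /hg h2 ->]].
by rewrite mdegD leq_add.
Qed.

Lemma degree_boundedX f M e : degree_bounded f M -> degree_bounded (f ^+ e) (e * M).
Proof.
move=> hf; elim: e => [|e IH].
  by move=> m; rewrite expr0 msupp1 inE => /eqP ->; rewrite mdeg0.
by rewrite exprS mulSn; apply: degree_boundedM.
Qed.

(* The constant coefficient [h 0] lies in [Q] because [f] does; once it is known
   to vanish, a factor [f] can be cancelled modulo [P]. *)
Lemma coefs_eq0_mod P Q f d (h : nat -> R) :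
  prime_ideal P -> is_ideal Q -> (P `<=` Q)%classic -> Q f -> ~ P f ->
  (forall a, (a < d)%N -> Q (h a) -> h a = 0) ->
  P (\sum_(a < d) h a * f ^+ a) -> forall a, (a < d)%N -> h a = 0.
Proof.
move=> [iP _ pP] iQ PQ Qf Pf; elim: d h => // d IH h hL.
rewrite big_ord_recl expr0 mulr1.
under eq_bigr do rewrite exprSr mulrA.
rewrite -mulr_suml; set S := \sum_(_ < d) _ => PS.
have h0 : h 0%N = 0.
  apply: hL => //; rewrite -[h 0%N](addrK (S * f)).
  by apply: idealD => //; [exact: PQ|apply: idealN => //; exact: idealMl].
rewrite h0 add0r in PS; have [PS'|//] := pP _ _ PS.
case=> // a ad; apply: (IH (fun a => h a.+1)) => // b bd; exact: hL.
Qed.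

(** Grouped by powers of [f], a combination has its coefficients in the span of the [g t], which
    meets [Q] only in zero; so [coefs_eq0_mod] applies. *)
Lemma independent_mod_powers (T : finType) (g : T -> R) P Q f d :
  prime_ideal P -> is_ideal Q -> (P `<=` Q)%classic -> Q f -> ~ P f ->
  independent_mod g Q ->
  independent_mod (fun ta : T * 'I_d => g ta.1 * f ^+ ta.2) P.
Proof.
move=> pP iQ PQ Qf Pf ig c.
(* [coefs_eq0_mod] indexes coefficients by all natural numbers, so [c] is extended by zero from [d]
   on. *)
pose h a := \sum_t (if insub a is Some a' then c (t, a') else 0) *: g t.
have -> : \sum_ta c ta *: (g ta.1 * f ^+ ta.2) = \sum_(a < d) h a * f ^+ a.
  transitivity (\sum_t \sum_(a < d) c (t, a) *: (g t * f ^+ a)).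
    by rewrite pair_bigA; apply: eq_bigr => -[t a].
  rewrite exchange_big /=.
  apply: eq_bigr => a _; rewrite mulr_suml; apply: eq_bigr => t _.
  by rewrite valK scalerAl.
have hL a : (a < d)%N -> Q (h a) ->
    forall t, (if insub a is Some a' then c (t, a') else 0) = 0.
  by move=> ad /ig.
move=> PS [t a]; have := hL a (ltn_ord a); rewrite valK => -> //.
suff -> : h a = 0 by exact: ideal0.
apply: (coefs_eq0_mod (d := d) pP iQ PQ Qf Pf) PS _ _ => // b bd Qb.
by rewrite /h big1 // => u _; rewrite hL // scale0r.
Qed.

(** Total degree at most [M] bounds each exponent by [M], which leaves [M.+1 ^ n] monomials; the
    coefficient matrix has independent rows. *)
Lemma independent_card (T : finType) (g : T -> R) M :
  independent_mod g [set 0]%classic -> (forall t, degree_bounded (g t) M) ->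
  (#|T| <= M.+1 ^ n)%N.
Proof.
move=> ig gM.
pose mon (e : {ffun 'I_n -> 'I_M.+1}) : 'X_{1..n} := [multinom val (e j) | j < n].
pose A : 'M[k]_(#|T|, #|{ffun 'I_n -> 'I_M.+1}|) :=
  \matrix_(i, j) (g (enum_val i))@_(mon (enum_val j)).
have -> : (M.+1 ^ n = #|{ffun 'I_n -> 'I_M.+1}|)%N by rewrite card_ffun !card_ord.
suff /eqP <- : row_free A by apply: rank_leq_col.
apply: inj_row_free => v vA.
have S0 : \sum_t v 0 (enum_rank t) *: g t = 0.
  apply/mpolyP => m; rewrite mcoeff0 raddf_sum /=.
  under eq_bigr do rewrite mcoeffZ.
  case: (boolP [forall j, (m j <= M)%N]) => [/forallP mM|]; last first.
    rewrite negb_forall => /existsP[j]; rewrite -ltnNge => mj.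
    rewrite big1 // => t _; rewrite memN_msupp_eq0 ?mulr0 //.
    apply/negP => /gM; rewrite leqNgt => /negP; apply.
    apply: leq_trans mj _; rewrite mdegE (bigD1 j) //=; exact: leq_addr.
  pose e : {ffun 'I_n -> 'I_M.+1} := [ffun j => inord (m j)].
  have em : mon e = m by apply/mnmP => j; rewrite mnmE ffunE /= inordK // ltnS.
  move/rowP/(_ (enum_rank e)) : vA; rewrite !mxE => vA.
  rewrite -[RHS]vA (reindex (@enum_val T T)) /=; last first.
    by apply: onW_bij; apply: enum_val_bij.
  by apply: eq_bigr => i _; rewrite mxE enum_valK enum_rankK em.
apply/rowP => i; rewrite mxE -[i]enum_valK.
exact: (ig (fun t => v 0 (enum_rank t))).
Qed.

(** In a chain with [h > n], the products of powers below [d] of [n.+1] of the [f j] would be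
    [d ^ n.+1] independent polynomials of degree linear in [d], whereas the available monomials grow
    only like the [n]-th power of [d]. *)
Lemma prime_chain_length P h : prime_chain_to P h -> (h <= n)%N.
Proof.
move=> [c [cprime clt _]]; rewrite leqNgt; apply/negP => nh.
have /choice[f hf] : forall j, exists f, (j < h)%N -> c j.+1 f /\ ~ c j f.
  move=> j; case: (ltnP j h) => [jh|]; last by exists 0.
  have [_ /nonsubset[f [fj1 fj]]] := clt j jh.
  by exists f.
pose D := (\max_(j < h) msize (f j))%N.
have fD j : (j < h)%N -> degree_bounded (f j) D.
  move=> jh m /msize_mdeg_lt /ltnW /leq_trans; apply.
  exact: (leq_bigmax (Ordinal jh)).
(* The induction descends from the top prime, modulo which [1] is independent; each step down brings
   in the powers of one more [f]. *)
have family d j : (j <= h)%N -> exists T : finType, exists g : T -> R,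
    [/\ #|T| = (d ^ j)%N, independent_mod g (c (h - j)%N)
      & forall t, degree_bounded (g t) (j * (d * D))].
  elim: j => [|j IH] jh.
    exists 'I_1, (fun _ => 1); split; first by rewrite card_ord.
      rewrite subn0 => a; rewrite big_ord1 => ca t; rewrite (ord1 t).
      have [iP P1 _] := cprime h (leqnn h); apply/eqP/negPn/negP => a0; apply: P1.
      rewrite -[1](scale1r) -(mulVf a0) -scalerA; exact: idealZ.
    by move=> _ m; rewrite msupp1 inE => /eqP->; rewrite mdeg0.
  have [T [g [cT ig gM]]] := IH (ltnW jh).
  have eh : (h - j = (h - j.+1).+1)%N by rewrite subnSK.
  have lth : (h - j.+1 < h)%N by rewrite -eh leq_subr.
  have [fQ fP] := hf _ lth.
  exists (T * 'I_d)%type, (fun ta : T * 'I_d => g ta.1 * f (h - j.+1)%N ^+ ta.2).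
  split.
  - by rewrite card_prod cT card_ord expnSr.
  - rewrite eh in ig; apply: independent_mod_powers fQ fP ig.
    + exact/cprime/ltnW.
    + by have [] := cprime _ lth.
    + by have [] := clt _ lth.
  - move=> [t a] m /= hm; rewrite mulSn addnC.
    have /(_ m hm) := degree_boundedM (gM t) (degree_boundedX (e := a) (fD _ lth)).
    move/leq_trans; apply; rewrite leq_add2l leq_mul2r (ltnW (ltn_ord a)).
    by rewrite orbT.
(* With this [C] the number of monomials is at most [(d * C) ^ n], which is below [d ^ n.+1] as soon
   as [d] exceeds [C ^ n]. *)
pose C := (n.+1 * D).+1; pose d := (C ^ n).+1.
have [T [g [cT ig gM]]] := family d _ nh.
have ig0 : independent_mod g [set 0]%classic.
  move=> a a0; apply: ig; rewrite (a0 : _ = 0).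
  by apply: ideal0; have [] := cprime _ (leq_subr n.+1 h).
have := independent_card ig0 gM; rewrite cT leqNgt => /negP[].
apply: (@leq_ltn_trans ((d * C) ^ n)).
  case: (posnP n) => [->//|n0]; rewrite leq_exp2r // mulnCA /C mulnS.
  by rewrite -[X in (X <= _)%N]add1n leq_add2r.
by rewrite expnMn expnSr ltn_pmul2l // expn_gt0.
Qed.

Lemma prime_chain_extend P Q h :
  prime_ideal Q -> (P `<` Q)%classic -> prime_chain_to P h -> prime_chain_to Q h.+1.
Proof.
move=> pQ PQ [c [cp clt ch]].
exists (fun j => if (j <= h)%N then c j else Q); split.
- by move=> j _; case: ifP => [/cp|].
- move=> j; rewrite ltnS.
  by case: (ltngtP j h) => [/clt||->]; rewrite ?leqnn ?ltnn ?ch.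
- by rewrite /= ltnn.
Qed.

Definition var_ideal (B : {set 'I_n}) : set R :=
  ideal_gen [set f | exists2 i : 'I_n, i \in B & f = 'X_i]%classic.

(** Setting the variables of [B] to zero is a ring endomorphism with kernel [var_ideal B]; as [R] is
    a domain, that ideal is prime. *)
Definition kill_vars (B : {set 'I_n}) : R -> R :=
  mmap (@mpolyC n k) (fun i => if i \in B then 0 else 'X_i).

Implicit Types (B : {set 'I_n}).

Lemma ideal_gen_is_ideal (G : set R) : is_ideal (ideal_gen G).
Proof.
split=> [|f g hf hg|a f hf] L [iL LG]; first exact: ideal0.
  by apply: idealD => //; [apply: hf|apply: hg].
by apply: idealMl => //; apply: hf.
Qed.

Lemma kill_varsX B m :
  kill_vars B 'X_[m] = if [exists (i | i \in B), m i != 0%N] then 0 else 'X_[m].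
Proof.
rewrite /kill_vars mmapX /mmap1; case: ifP => [/exists_inP[i iB mi]|/negbT].
  by rewrite (bigD1 i) //= iB expr0n (negbTE mi) mul0r.
move/exists_inPn => h; rewrite mpolyXE_id; apply: eq_bigr => i _.
by case: ifP => // /h /negPn/eqP ->; rewrite !expr0.
Qed.

Lemma kill_vars_is_ideal B : is_ideal [set f | kill_vars B f = 0]%classic.
Proof.
rewrite /kill_vars; split=> /= [|f g hf hg|a f hf].
- by rewrite raddf0.
- by rewrite raddfD /= hf hg addr0.
- by rewrite rmorphM /= hf mulr0.
Qed.

(** For the converse, [f - kill_vars B f] always lies in the ideal, as is checked on monomials. *)
Lemma var_idealP B f : var_ideal B f <-> kill_vars B f = 0.
Proof.
split=> [h|h].
  apply: (h _ (conj (kill_vars_is_ideal B) _)) => _ [i iB ->] /=.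
  rewrite kill_varsX ifT //; apply/exists_inP; exists i => //.
  by rewrite mnm1E eqxx.
have iV := ideal_gen_is_ideal [set f | exists2 i : 'I_n, i \in B & f = 'X_i]%classic.
rewrite -[f]subr0 -h {h}; elim/mpolyind: f => [|c m p _ _ IH].
  by rewrite /kill_vars raddf0 subr0; exact: ideal0 iV.
rewrite /kill_vars raddfD /= opprD addrACA; apply: (idealD iV) => //.
rewrite mmapZ mul_mpolyC -scalerBr; apply: (idealZ _ iV).
rewrite -/(kill_vars B 'X_[m]) kill_varsX.
case: ifP => [/exists_inP[i iB mi]|_]; last by rewrite subrr; exact: ideal0 iV.
rewrite subr0 -(submK (m := U_(i)%MM) (m' := m)); last by rewrite lep1mP.
rewrite mpolyXD; apply: (idealMl _ iV).
by apply: sub_gen_smallest; exists i.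
Qed.

Lemma var_ideal_is_ideal B : is_ideal (var_ideal B).
Proof. exact: ideal_gen_is_ideal. Qed.

Lemma var_ideal_prime B : prime_ideal (var_ideal B).
Proof.
split; first exact: var_ideal_is_ideal.
  by move/var_idealP/eqP; rewrite /kill_vars rmorph1 oner_eq0.
move=> f g /var_idealP; rewrite /kill_vars rmorphM /= => /eqP.
by rewrite mulf_eq0 => /orP[]/eqP h; [left|right]; apply/var_idealP.
Qed.

Lemma var_idealX B m : var_ideal B 'X_[m] <-> exists2 i, i \in B & m i != 0%N.
Proof.
split=> [/var_idealP|h]; last first.
  apply/var_idealP; rewrite kill_varsX ifT //.
  by have [i iB mi] := h; apply/exists_inP; exists i.
rewrite kill_varsX.
case: ifP => [/exists_inP[i iB mi] _|_ /mpolyP/(_ m)/eqP]; first by exists i.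
by rewrite mcoeffX mcoeff0 eqxx oner_eq0.
Qed.

Lemma var_idealU B i : var_ideal B 'X_i <-> i \in B.
Proof.
split=> [/var_idealX[j jB]|iB]; last first.
  by apply/var_idealX; exists i; rewrite // mnm1E eqxx.
by rewrite mnm1E; have [->|] := eqVneq i j.
Qed.

Lemma var_ideal_sub B P : is_ideal P ->
  (var_ideal B `<=` P)%classic <-> forall i, i \in B -> P 'X_i.
Proof.
move=> iP; split=> [h i iB|h]; first by apply/h/var_idealU.
by apply: smallest_sub => // _ [i iB ->]; apply: h.
Qed.

Lemma var_idealS B1 B2 :
  (var_ideal B1 `<=` var_ideal B2)%classic <-> B1 \subset B2.
Proof.
split=> [/(var_ideal_sub _ (var_ideal_is_ideal _)) h|/fintype.subsetP h].
  by apply/fintype.subsetP => i /h /var_idealU.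
by apply/var_ideal_sub; [exact: var_ideal_is_ideal|move=> i /h /var_idealU].
Qed.

Lemma var_ideal_inj : injective var_ideal.
Proof.
move=> B1 B2 e; apply/eqP; rewrite finset.eqEsubset; apply/andP; split;
  by apply/var_idealS; rewrite e.
Qed.

Lemma var_ideal_proper B i : i \notin B ->
  (var_ideal B `<` var_ideal (i |: B))%classic.
Proof.
move=> iB; split; first by apply/var_idealS; rewrite finset.subsetUr.
move/var_idealS/fintype.subsetP/(_ i).
by rewrite finset.setU11 (negbTE iB) => /(_ isT).
Qed.

Lemma var_ideal_chain B : prime_chain_to (var_ideal B) #|B|.
Proof.
have [m] := ubnP #|B|; elim: m B => // m IH B Bm.
have [->|[i iB]] := set_0Vmem B.
  rewrite cards0; exists (fun _ => var_ideal finset.set0); split=> // j _.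
  exact: var_ideal_prime.
rewrite (cardsD1 i) iB add1n; apply: (@prime_chain_extend (var_ideal (B :\ i))).
- exact: var_ideal_prime.
- by rewrite -{2}(finset.setD1K iB); apply: var_ideal_proper; rewrite finset.setD11.
- by apply: IH; rewrite (cardsD1 i) iB in Bm.
Qed.

(** Adding the missing variables one by one prolongs the chain by [#|~: B|] steps, and the total
    length is at most [n]. *)
Lemma var_ideal_chain_length B h : prime_chain_to (var_ideal B) h -> (h <= #|B|)%N.
Proof.
have [m] := ubnP #|~: B|; elim: m B h => // m IH B h Bm ch.
have [BT|[i]] := set_0Vmem (~: B).
  rewrite -(finset.setCK B) BT finset.setC0 cardsT card_ord.
  exact: prime_chain_length ch.
rewrite inE => iB; have := @IH (i |: B) h.+1; rewrite cardsU1 iB add1n; apply.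
  rewrite finset.setCU finset.setIC -finset.setDE.
  by move: Bm; rewrite (cardsD1 i (~: B)) inE iB.
apply: prime_chain_extend ch; first exact: var_ideal_prime.
exact: var_ideal_proper.
Qed.

Lemma var_ideal_has_height B h : has_height (var_ideal B) h <-> h = #|B|.
Proof.
have hB : prime_has_height (var_ideal B) #|B|.
  by split; [exact: var_ideal_chain|exact: var_ideal_chain_length].
have le P h' : prime_ideal P -> (var_ideal B `<=` P)%classic ->
    prime_has_height P h' -> (#|B| <= h')%N.
  move=> pP BP [_ hP]; case: (pselect (P `<=` var_ideal B)%classic) => PB.
    have e : var_ideal B = P by apply/seteqP.
    by apply: hP; rewrite -e; apply: var_ideal_chain.
  apply/ltnW/hP; apply: prime_chain_extend (var_ideal_chain B) => //.
have pB := var_ideal_prime B.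
split=> [[[P [pP BP hP]] hmin]|->]; last first.
  by split=> //; exists (var_ideal B); split.
by apply/eqP; rewrite eqn_leq (le P) // (hmin (var_ideal B)).
Qed.

Lemma height_var_ideal B : height (var_ideal B) = #|B|.
Proof.
apply: xget_unique; first exact/var_ideal_has_height.
by move=> h /var_ideal_has_height.
Qed.

End KrullDimension.

(** * Coordinate subspace arrangements *)

Section Arrangements.
Variables (k : fieldType) (n : nat).
Local Notation R := {mpoly k[n]}.
Local Notation coord B := (zeros (@var_ideal k n B)).
Implicit Types (P J : set R) (B F W : {set 'I_n}) (Z A : set (set R)).

Lemma prime_sqfree P W : prime_ideal P -> P (sqfree k W) ->
  exists2 i, i \in W & P 'X_i.
Proof.
move=> [iP P1 pP]; rewrite /sqfree -big_enum /=.
have : {subset enum W <= W} by move=> i; rewrite mem_enum.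
elim: (enum W) => [|i s IH] sW; first by rewrite big_nil => /P1.
rewrite big_cons => /pP[Pi|/IH[j js|j jW Pj]].
- by exists i => //; apply: sW; rewrite mem_head.
- by apply: sW; rewrite inE js orbT.
- by exists j.
Qed.

Lemma prime_monomial P m : prime_ideal P -> P 'X_[m] ->
  exists2 i, m i != 0%N & P 'X_i.
Proof.
move=> [iP P1 pP]; rewrite mpolyXE_id.
have pow i e : P ('X_i ^+ e) -> e != 0%N /\ P 'X_i.
  by elim: e => [/P1//|e IH]; rewrite exprS => /pP[//|/IH[]].
elim: (index_enum _) => [|i s IH]; first by rewrite big_nil => /P1.
by rewrite big_cons => /pP[/pow[mi Pi]|//]; exists i.
Qed.

Lemma zeros_var_idealP B P :
  coord B P <-> prime_ideal P /\ forall i, i \in B -> P 'X_i.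
Proof.
split=> -[pP h]; split=> //; have [iP _ _] := pP; exact/(var_ideal_sub B iP).
Qed.

Lemma coordS B1 B2 : (coord B1 `<=` coord B2)%classic <-> B2 \subset B1.
Proof.
split=> [h|/fintype.subsetP h P /zeros_var_idealP[pP hP]].
  have [_ /var_idealS//] : coord B2 (@var_ideal k n B1).
  by apply: h; split; first exact: var_ideal_prime.
by apply/zeros_var_idealP; split=> // i /h; apply: hP.
Qed.

Lemma coord_inj : injective (fun B => coord B).
Proof.
move=> B1 B2 e; apply/eqP; rewrite finset.eqEsubset; apply/andP; split;
  by apply/coordS; rewrite e.
Qed.

Lemma vanishing_ideal_coord B : vanishing_ideal (coord B) = @var_ideal k n B.
Proof.
apply/seteqP; split=> [f|f fB P [_ BP]]; last exact: BP.
by apply; split; first exact: var_ideal_prime.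
Qed.

Lemma zariski_closedU Z1 Z2 :
  zariski_closed Z1 -> zariski_closed Z2 -> zariski_closed (Z1 `|` Z2)%classic.
Proof.
move=> [J1 ->] [J2 ->].
exists [set h | exists f g, [/\ J1 f, J2 g & h = f * g]]%classic.
apply/seteqP; split=> [P [] [pP JP]|P [pP JP]].
- split=> // _ [f [g [/JP Pf _ ->]]]; have [iP _ _] := pP; exact: idealMr.
- split=> // _ [f [g [_ /JP Pg ->]]]; have [iP _ _] := pP; exact: idealMl.
case: (pselect (J1 `<=` P)%classic) => [|/nonsubset[f [J1f Pf]]]; first by left.
right; split=> // g J2g; have [_ _ mP] := pP.
by have /mP[] : P (f * g) by apply: JP; exists f, g.
Qed.

Lemma zariski_closed0 : @zariski_closed k n set0.
Proof.
exists setT; apply/seteqP; split=> // P [[_ P1 _] PT]; exact/P1/PT.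
Qed.

Lemma irreducible_bigcup Z (s : seq {set 'I_n}) : irreducible Z ->
  (forall P, Z P -> exists2 B, B \in s & coord B P) ->
  exists2 B, B \in s & (Z `<=` coord B)%classic.
Proof.
move=> [[P0 ZP0] irr].
suff closed (s' : seq {set 'I_n}) :
    zariski_closed [set P | exists2 B, B \in s' & coord B P]%classic.
  elim: s => [|B s IH] ZS; first by have [] := ZS _ ZP0.
  have [|||ZB|Zs] := irr (coord B) [set P | exists2 B', B' \in s & coord B' P]%classic.
  - by exists (@var_ideal k n B).
  - exact: closed.
  - move=> P /ZS[B']; rewrite inE => /orP[/eqP->|B's]; first by left.
    by right; exists B'.
  - by exists B => //; rewrite mem_head.
  - by have [B' B's ZB'] := IH Zs; exists B' => //; rewrite inE B's orbT.
elim: s' => [|B s' IH].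
  rewrite (_ : mkset _ = set0); first exact: zariski_closed0.
  by apply/seteqP; split=> // P [].
have := zariski_closedU (ex_intro _ (@var_ideal k n B) erefl) IH.
congr zariski_closed; apply/seteqP; split=> P.
  by move=> [BP|[B' B's BP]]; [exists B|exists B']; rewrite ?inE ?eqxx ?B's ?orbT.
move=> [B']; rewrite inE => /orP[/eqP->|B's]; first by left.
by right; exists B'.
Qed.

(** The prime [var_ideal B] is the generic point: a closed set containing it contains every larger
    prime. *)
Lemma irreducible_coord B : irreducible (coord B).
Proof.
have cB : coord B (@var_ideal k n B) by split=> //; exact: var_ideal_prime.
split=> [|_ _ [J1 ->] [J2 ->] /(_ _ cB)[] [_ JB]]; first by exists (@var_ideal k n B).
- by left=> P [pP BP]; split=> //; apply: subset_trans BP.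
- by right=> P [pP BP]; split=> //; apply: subset_trans BP.
Qed.

Section MonomialArrangement.
Variable I : set R.
Hypothesis hI : reduced_monomial_ideal I.

Definition covers F : bool := `[< (I `<=` @var_ideal k n F)%classic >].

(** A monomial of [I] outside the prime of [F] involves only variables outside [F], hence divides a
    power of [sqfree k (~: F)]; radicality then puts [sqfree k (~: F)] in [I]. *)
Lemma coversP F : covers F <-> ~ I (sqfree k (~: F)).
Proof.
split=> [/asboolP h /h|nI].
  move/(prime_sqfree (var_ideal_prime _ _)) => [i]; rewrite inE => iF /var_idealU.
  by rewrite (negbTE iF).
have [[M IM] [iI rI]] := hI; apply/asboolP; rewrite {1}IM.
apply: smallest_sub => [|_ [m Mm <-]]; first exact: var_ideal_is_ideal.
apply/var_idealX; apply: contrapT => nm; apply: nI.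
have Im : I 'X_[m] by rewrite IM; apply: sub_gen_smallest; exists m.
have m0 i : i \in F -> m i = 0%N.
  by move=> iF; apply/eqP/negPn/negP => mi; apply: nm; exists i.
apply: (rI _ (mdeg m)).
(* The total degree bounds every exponent of [m], so this power is a multiple of ['X_[m]]. *)
have -> : sqfree k (~: F) ^+ mdeg m =
    (\prod_i (if i \in ~: F then 'X_i ^+ (mdeg m - m i) else 1)) * 'X_[m].
  rewrite mpolyXE_id -big_split /= /sqfree -prodrXl big_mkcond /=.
  apply: eq_bigr => i _; rewrite inE; case: (boolP (i \in F)) => /= [/m0->|_].
    by rewrite expr0 mulr1.
  by rewrite -exprD subnK // mdegE (bigD1 i) //= leq_addr.
exact: idealMl.
Qed.

Lemma coversS F1 F2 : F1 \subset F2 -> covers F1 -> covers F2.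
Proof.
move=> /(@var_idealS k) h /asboolP h1; apply/asboolP; exact: subset_trans h1 h.
Qed.

(** Each monomial of [I] has a variable in the prime [P], so the variables lying in [P] form a
    cover. *)
Lemma zeros_covers P : zeros I P <-> exists2 F, covers F & coord F P.
Proof.
split=> [[pP IP]|[F /asboolP IF [pP FP]]]; last by split=> //; apply: subset_trans FP.
pose F := [set i | `[< P 'X_i >]].
exists F; last first.
  by apply/zeros_var_idealP; split=> // i; rewrite inE => /asboolP.
have [[M IM] _] := hI; apply/asboolP; rewrite {1}IM.
apply: smallest_sub => [|_ [m Mm <-]]; first exact: var_ideal_is_ideal.
have /(prime_monomial pP)[i mi Pi] : P 'X_[m].
  by apply: IP; rewrite IM; apply: sub_gen_smallest; exists m.
by apply/var_idealX; exists i => //; rewrite inE; apply/asboolP.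
Qed.

Lemma irreducible_componentP Z :
  irreducible_component (zeros I) Z <-> exists2 F, minset covers F & Z = coord F.
Proof.
(* An irreducible subset lies in one of the finitely many coordinate subspaces making up the
   arrangement; shrinking the cover enlarges the subspace. *)
have sub Z' : irreducible Z' -> (Z' `<=` zeros I)%classic ->
    exists2 F, minset covers F & (Z' `<=` coord F)%classic.
  move=> irr ZI; have [|F] := irreducible_bigcup (s := enum covers) irr.
    by move=> P /ZI/zeros_covers[F cF FP]; exists F; rewrite ?mem_enum.
  rewrite mem_enum => cF ZF; have [F0 mF0 F0F] := minset_exists cF.
  by exists F0 => //; apply: subset_trans ZF _; apply/coordS.
split=> [[ZI irr Zmax]|[F mF ->]].
  have [F mF ZF] := sub _ irr ZI; exists F => //; apply/esym/Zmax => //.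
    by move=> P FP; apply/zeros_covers; exists F => //; apply: minsetp mF.
  exact: irreducible_coord.
have cF := minsetp mF.
split; [|exact: irreducible_coord|].
  by move=> P FP; apply/zeros_covers; exists F.
move=> Z' Z'I irr FZ'; have [F' mF' Z'F'] := sub _ irr Z'I.
have F'F : F' \subset F by apply/coordS/(subset_trans FZ').
have e : F' = F by have [_] := minsetP mF; apply => //; apply: minsetp mF'.
by apply/seteqP; split=> //; rewrite -e.
Qed.

(* The components of the arrangement are the coordinate subspaces given by the
   minimal covers, so their intersections are given by the unions of non-empty
   families of minimal covers: these are encoded as the fixed points of
   [cover_hull] that contain a minimal cover. *)
Definition cover_hull B : {set 'I_n} :=
  (\bigcup_(F | minset covers F && (F \subset B)) F)%SET.

Definition cover_union B : bool :=
  [exists F, minset covers F && (F \subset B)] && (cover_hull B == B).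

Lemma cover_hull_sub B : cover_hull B \subset B.
Proof. by apply/finset.bigcupsP => F /andP[]. Qed.

Lemma cover_hullS B1 B2 : B1 \subset B2 -> cover_hull B1 \subset cover_hull B2.
Proof.
move=> B12; apply/finset.bigcupsP => F /andP[mF FB].
by apply: (finset.bigcup_sup F) => //; rewrite mF (fintype.subset_trans FB).
Qed.

Lemma cover_union_hull B F : minset covers F -> F \subset B ->
  cover_union (cover_hull B).
Proof.
move=> mF FB; have sub F' : minset covers F' -> F' \subset B ->
    F' \subset cover_hull B.
  by move=> mF' FB'; apply: (finset.bigcup_sup F') => //; rewrite mF' FB'.
apply/andP; split; first by apply/existsP; exists F; rewrite mF sub.
rewrite finset.eqEsubset cover_hull_sub /=.
apply/finset.bigcupsP => F' /andP[mF' FB'].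
by apply: (finset.bigcup_sup F') => //; rewrite mF' sub.
Qed.

Lemma cover_union_minset F : minset covers F -> cover_union F.
Proof.
move=> mF; apply/andP; split; first by apply/existsP; exists F; rewrite mF /=.
rewrite finset.eqEsubset cover_hull_sub /=.
by apply: (finset.bigcup_sup F) => //; rewrite mF /=.
Qed.

Lemma component_intersectionsP Y :
  component_intersections (zeros I) Y <-> exists2 B, cover_union B & Y = coord B.
Proof.
split=> [[C [[Z0 CZ0] Ccomp ->]]|[B /andP[/existsP[F /andP[mF FB]] /eqP eB] ->]].
  pose S := [set F | minset covers F && `[< C (coord F) >]].
  have SC F : F \in S -> C (coord F) by rewrite inE => /andP[_ /asboolP].
  pose B := (\bigcup_(F in S) F)%SET.
  have FB F : F \in S -> F \subset B by move=> FS; apply: (finset.bigcup_sup F).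
  have /irreducible_componentP[F0 mF0 eF0] := Ccomp _ CZ0.
  have F0S : F0 \in S by rewrite inE mF0; apply/asboolP; rewrite -eF0.
  exists B.
    apply/andP; split; first by apply/existsP; exists F0; rewrite mF0 FB.
    rewrite finset.eqEsubset cover_hull_sub /=; apply/finset.bigcupsP => F FS.
    apply: (finset.bigcup_sup F) => //; rewrite FB // andbT.
    by move: FS; rewrite inE => /andP[].
  apply/seteqP; split=> [P PC|P /zeros_var_idealP[pP PB] Z CZ].
    apply/zeros_var_idealP; split; first by have [] := PC _ (SC _ F0S).
    move=> i /finset.bigcupP[F FS iF].
    by have /zeros_var_idealP[_] := PC _ (SC _ FS); apply.
  have /irreducible_componentP[F mF eF] := Ccomp _ CZ.
  rewrite eF; apply/zeros_var_idealP; split=> // i iF; apply: PB.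
  by apply/finset.bigcupP; exists F => //; rewrite inE mF; apply/asboolP; rewrite -eF.
(* [B] is the union of all minimal covers inside it, so their components intersect in [coord B]. *)
exists [set Z | exists F', [/\ minset covers F', F' \subset B & Z = coord F']]%classic.
split.
- by exists (coord F), F.
- by move=> _ [F' [mF' _ ->]]; apply/irreducible_componentP; exists F'.
apply/seteqP; split=> [P PB _ [F' [mF' F'B ->]]|P PC].
  by apply: (coordS B F').2 P PB.
have [pP _] : coord F P by apply: PC; exists F.
apply/zeros_var_idealP; split=> // i.
rewrite -eB => /finset.bigcupP[F' /andP[mF' F'B] iF'].
have /zeros_var_idealP[_] : coord F' P by apply: PC; exists F'.
exact.
Qed.

Lemma finite_component_intersections :
  finite_set (component_intersections (zeros I)).
Proof.
have -> : component_intersections (zeros I) =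
    ((fun B => coord B) @` [set B | cover_union B])%classic.
  apply/seteqP; split=> [Y /component_intersectionsP[B uB ->]|_ [B uB <-]].
    by exists B.
  by apply/component_intersectionsP; exists B.
exact/finite_image/finite_finset.
Qed.

Lemma exists_label (p : arr_poset I) : exists B, cover_union B /\ arr_space p = coord B.
Proof.
have := fsvalP p; rewrite in_fset_set; last exact: finite_component_intersections.
by rewrite inE => /component_intersectionsP[B uB e]; exists B.
Qed.

Definition label (p : arr_poset I) : {set 'I_n} := xget finset.set0
  [set B | cover_union B /\ arr_space p = coord B]%classic.

Lemma labelP p : cover_union (label p) /\ arr_space p = coord (label p).
Proof.
exact: (@xgetPex _ _ [set B | cover_union B /\ arr_space p = coord B]%classic
  (exists_label p)).
Qed.

Lemma label_inj : injective label.
Proof.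
move=> p q e; apply: val_inj; have [_ ep] := labelP p; have [_ eq] := labelP q.
by rewrite [LHS]ep [RHS]eq e.
Qed.

Lemma label_surj B : cover_union B -> exists p, label p = B.
Proof.
move=> uB; have Bc : coord B \in fset_set (component_intersections (zeros I)).
  rewrite in_fset_set; last exact: finite_component_intersections.
  by rewrite inE; apply/component_intersectionsP; exists B.
exists [` Bc]%fset; apply: coord_inj; have [_ <-] := labelP [` Bc]%fset.
by [].
Qed.

Lemma arr_ltE p q : arr_lt p q = (label q \proper label p).
Proof.
rewrite /arr_lt (labelP p).2 (labelP q).2 properE.
apply/asboolP/andP => [[h1 h2]|[h1 h2]]; split.
- exact/coordS.
- by apply/negP => /coordS.
- exact/coordS.
- by move/coordS; apply/negP.
Qed.

Lemma label_top B (p : arr_poset I) : label p \subset B ->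
  exists2 q, label q \subset B & forall u, label u \subset B -> label u \subset label q.
Proof.
move=> pB; have [/andP[/existsP[F /andP[mF Fp]] _] _] := labelP p.
have [q eq] := label_surj (cover_union_hull mF (fintype.subset_trans Fp pB)).
exists q; rewrite eq ?cover_hull_sub // => u uB.
by have [/andP[_ /eqP <-] _] := labelP u; apply: cover_hullS.
Qed.

(** Every cover contains a minimal cover, which is a label, and every label is a cover. *)
Lemma alexander_dualE :
  alexander_dual I = ideal_gen [set f | exists v, f = sqfree k (label v)]%classic.
Proof.
apply/seteqP; split; apply: smallest_sub; try exact: ideal_gen_is_ideal.
  move=> _ [S /coversP cS ->]; have [F mF FS] := minset_exists cS.
  have [p ep] := label_surj (cover_union_minset mF).
  rewrite /sqfree (big_setID F) /= (finset.setIidPr FS) -ep mulrC.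
  apply: (idealMl _ (ideal_gen_is_ideal _)).
  by apply: sub_gen_smallest; exists p.
move=> _ [p ->]; apply: sub_gen_smallest; exists (label p) => //.
apply/coversP; have [/andP[/existsP[F /andP[mF Fp]] _] _] := labelP p.
exact: coversS Fp (minsetp mF).
Qed.

Lemma arr_idealE p : arr_ideal p = @var_ideal k n (label p).
Proof. by rewrite /arr_ideal (labelP p).2 vanishing_ideal_coord. Qed.

End MonomialArrangement.

End Arrangements.

(** * * Betti numbers of the Alexander dual *)

Lemma set_degree_opp n (alpha : 'rV[int]_n) :
  (forall j, alpha 0 j = -1 \/ alpha 0 j = 0) ->
  - alpha = set_degree [set j | alpha 0 j == -1].
Proof.
move=> h; apply/rowP => j; rewrite !mxE inE.
by have [->|->] := h j.
Qed.

Lemma abs_weightE n (alpha : 'rV[int]_n) :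
  (forall j, alpha 0 j = -1 \/ alpha 0 j = 0) ->
  abs_weight alpha = #|[set j | alpha 0 j == -1]|%:Z.
Proof.
move=> h; rewrite /abs_weight -sum1_card (big_morph Posz PoszD (erefl _)).
rewrite [RHS]big_mkcond /=.
by apply: eq_bigr => j _; rewrite inE; have [->|->] := h j.
Qed.

Lemma face_idealE (k : fieldType) n (alpha : 'rV[int]_n) :
  face_ideal alpha = @var_ideal k n [set j | alpha 0 j == -1].
Proof.
rewrite /face_ideal /var_ideal; congr ideal_gen.
apply/seteqP; split=> _ [i hi ->]; exists i => //.
- by rewrite inE hi.
- by move: hi; rewrite inE => /eqP.
Qed.

Theorem corollary2p2 (k : fieldType) (n : nat) (I : set {mpoly k[n]})
    (hI : reduced_monomial_ideal I) (alpha : 'rV[int]_n)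
    (halpha : forall j, alpha 0 j = -1 \/ alpha 0 j = 0) (i : nat) :
  graded_betti (alexander_dual I) i (- alpha)
  = mult I (abs_weight alpha - i%:Z) alpha.
Proof.
have JE := alexander_dualE hI.
pose F := chain_resolution (arr_ltE hI) (label_inj hI) (label_top hI) JE.
rewrite (graded_bettiE F) set_degree_opp // /mult; case: pickP => [p|noface].
  rewrite face_idealE (arr_idealE hI) => /asboolP/var_ideal_inj eA.
  rewrite /mult_at (arr_idealE hI) height_var_ideal abs_weightE // eA tor_dim_chain.
  (* As [h(p)] equals [|alpha|], the degree [h(p) - (|alpha| - i) - 1] is [i - 1]. *)
  by congr reduced_homology_dim; rewrite opprB [_ + (i%:Z - _)]addrC subrK.
(* If the prime of [alpha] defines no element of [P(X)], then no chain of the resolution lies in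
   degree [- alpha]. *)
apply: tor_dim_chain_eq0 => p; apply: contraFneq (noface p) => eA.
by apply/asboolP; rewrite face_idealE (arr_idealE hI) eA.
Qed.
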